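(* Let $n\ge2$. The $\mathbb Q$-span $\mathfrak A_{\vartriangle,\mathbb Q}[n]$ of the elements $A[\mathbf j]$ ($A\in\Theta^\pm_\vartriangle(n)$, $\mathbf j\in\mathbb N^n_\vartriangle$) is a subalgebra of $\prod_{r\ge0}\mathcal S_\vartriangle(n,r)_{\mathbb Q}$, with $\mathbb Q$-basis $\{A[\mathbf j]\mid A\in\Theta^\pm_\vartriangle(n),\ \mathbf j\in\mathbb N^n_\vartriangle\}$. Moreover the map $\eta=\prod_{r\ge0}\eta_r:\mathcal U(\widehat{\mathfrak{gl}}_n)\to\prod_{r\ge0}\mathcal S_\vartriangle(n,r)_{\mathbb Q}$ is injective and induces a $\mathbb Q$-algebra isomorphism $\mathcal U(\widehat{\mathfrak{gl}}_n)\cong\mathfrak A_{\vartriangle,\mathbb Q}[n]$.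
   Context: The loop algebra $\widehat{\mathfrak{gl}}_n=\mathfrak{gl}_n(\mathbb Q)\otimes\mathbb Q[t,t^{-1}]$ is identified with the Lie algebra (commutator bracket) of $\mathbb Z\times\mathbb Z$ rational matrices $(a_{i,j})$ with $a_{i+n,j+n}=a_{i,j}$ and finitely many nonzero entries in each row; it has basis $E^\vartriangle_{i,j}$ ($1\le i\le n$, $j\in\mathbb Z$), where $E^\vartriangle_{i,j}$ has $1$ at positions $(i+sn,j+sn)$, $s\in\mathbb Z$, and $0$ elsewhere. $\mathcal U(\widehat{\mathfrak{gl}}_n)$ is its universal enveloping algebra. It acts on $\Omega_{\mathbb Q}$ (basis $\omega_k$, $k\in\mathbb Z$) by $E^\vartriangle_{i,j}\omega_k=\omega_{i+tn}$ if $k=j+tn$ ($t\in\mathbb Z$) and $0$ otherwise, and on $\Omega_{\mathbb Q}^{\otimes r}$ by $x(w_1\otimes\cdots\otimes w_r)=\sum_s w_1\otimes\cdots\otimes xw_s\otimes\cdots\otimes w_r$. $I_\vartriangle(n,r)$ is the set of integer sequences $\mathbf i=(i_k)_{k\in\mathbb Z}$ with $i_{k+r}=i_k+n$; $\omega_{\mathbf i}:=\omega_{i_1}\otimes\cdots\otimes\omega_{i_r}$. The affine symmetric group $\mathfrak S_{\vartriangle,r}$ (bijections $w:\mathbb Z\to\mathbb Z$, $w(k+r)=w(k)+r$) acts on the right by $\omega_{\mathbf i}w=\omega_{\mathbf iw}$, $(\mathbf iw)_k=i_{w(k)}$; this commutes with the $\mathcal U(\widehat{\mathfrak{gl}}_n)$-action,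 giving algebra homomorphisms $\eta_r:\mathcal U(\widehat{\mathfrak{gl}}_n)\to\mathcal S_\vartriangle(n,r)_{\mathbb Q}:=\mathrm{End}_{\mathbb Q\mathfrak S_{\vartriangle,r}}(\Omega_{\mathbb Q}^{\otimes r})$ (composition as product; $\mathcal S_\vartriangle(n,0)_{\mathbb Q}=\mathbb Q$). $\Theta_\vartriangle(n)$ is the set of matrices over $\mathbb N$ with $a_{k+n,l+n}=a_{k,l}$ and finitely many nonzero entries per row; $\sigma(A)=\sum_{1\le k\le n,\,l}a_{k,l}$; $\Theta_\vartriangle(n,r)=\{A\mid\sigma(A)=r\}$; $\Theta^\pm_\vartriangle(n)$ consists of those $A$ with zero diagonal. For $\mathbf i,\mathbf j\in I_\vartriangle(n,r)$, $M(\mathbf i,\mathbf j)=(a_{k,l})$ with $a_{k,l}=|\{s\in\mathbb Z\mid i_s=k,\ j_s=l\}|$; for $A\in\Theta_\vartriangle(n,r)$, $[A]_1$ is the endomorphism $\omega_{\mathbf j}\mapsto\sum_{\mathbf i:M(\mathbf i,\mathbf j)=A}\omega_{\mathbf i}$. $\mathbb N^n_\vartriangle$ is the set of $n$-periodic sequences of nonnegative integers, $\Lambda_\vartriangle(n,m)=\{\lambda\in\mathbb N^n_\vartriangle\mid\sum_{i=1}^n\lambda_i=m\}$, $\mathrm{diag}(\lambda)$ the diagonal matrix with entries $\lambda_i$, $\lambda^{\mathbf j}=\prod_{i=1}^n\lambda_i^{j_i}$ ($0^0=1$). For $A\in\Theta^\pm_\vartriangle(n)$: $A[\mathbf j,r]=\sum_{\lambda\in\Lambda_\vartriangle(n,r-\sigma(A))}\lambda^{\mathbf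 j}[A+\mathrm{diag}(\lambda)]_1$ if $\sigma(A)\le r$ and $0$ otherwise, and $A[\mathbf j]=(A[\mathbf j,r])_{r\ge0}\in\prod_{r\ge0}\mathcal S_\vartriangle(n,r)_{\mathbb Q}$ (componentwise product). *)

(* Defs.v *)
From HB Require Import structures.
From mathcomp Require Import all_boot all_order all_algebra.
From mathcomp Require Import boolp classical_sets fsbigop.
From Stdlib Require List.
Unset Printing Implicit Defensive.
Import Order.TTheory GRing.Theory Num.Theory.
Local Open Scope ring_scope.

Definition ThetaPM (n : nat) (A : int -> int -> nat) : Prop :=
  (forall k l, A (k + n%:Z) (l + n%:Z) = A k l) /\
  (forall k, A k k = 0%N) /\
  (forall k, exists N : nat, forall l : int, (N < `|l|)%N -> A k l = 0%N).

Definition NnD (n : nat) (j : int -> nat) : Prop := forall k, j (k + n%:Z) = j k.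

Definition sigmaA (n : nat) (A : int -> int -> nat) : nat :=
  (\sum_(k < n) \big[addn/0%N]_(l \in [set: int]) A (Posz k.+1) l)%N.

Definition LambdaD (n m : nat) : set (int -> nat) :=
  [set la | NnD n la /\ (\sum_(i < n) la (Posz i.+1))%N = m].

Definition diagM (la : int -> nat) : int -> int -> nat :=
  fun k l => if k == l then la k else 0%N.

Definition addM (A B : int -> int -> nat) : int -> int -> nat :=
  fun k l => (A k l + B k l)%N.

(* lambda^j = prod_{i=1}^n lambda_i^{j_i}, with 0^0 = 1 *)
Definition lampow (n : nat) (la j : int -> nat) : nat :=
  (\prod_(i < n) (la (Posz i.+1)) ^ (j (Posz i.+1)))%N.

(* I_Delta(n,r): a sequence i with i_{k+r} = i_k + n is determined by       *)
(* (i_1,...,i_r), encoded as a seq int of size r.  extI recovers i_k.     *)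
Definition extI (n : nat) (i : seq int) (k : int) : int :=
  let r := (size i)%:Z in
  nth 0 i `|((k - 1) %% r)%Z|%N + n%:Z * ((k - 1) %/ r)%Z.

Definition Mmat (n : nat) (i j : seq int) : int -> int -> nat :=
  if size i == 0%N then fun _ _ => 0%N else
  fun k l => \big[addn/0%N]_(s \in [set: int])
               ((extI n i s == k) && (extI n j s == l) : nat).

(* Endomorphisms of Omega^{\otimes r}, for all r, by matrix coefficients: *)
(* X r i j = coefficient of omega_i in X_r(omega_j), for i,j of size r.  *)
Definition Op := nat -> seq int -> seq int -> rat.

Definition zeroOp : Op := fun _ _ _ => 0.
Definition IdOp : Op := fun r i k => ((size i == r) && (i == k))%:R.
Definition mulOp (X Y : Op) : Op :=
  fun r i k => \sum_(j \in [set: seq int]) X r i j * Y r j k.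

Definition Abr1 (n : nat) (A : int -> int -> nat) : Op :=
  fun r i k => if [&& size i == r, size k == r & `[< Mmat n i k = A >]]
               then 1 else 0.

Definition Aj (n : nat) (A : int -> int -> nat) (j : int -> nat) : Op :=
  fun r i k =>
    if (sigmaA n A <= r)%N then
      \sum_(la \in LambdaD n (r - sigmaA n A)) (lampow n la j)%:R
                                             * Abr1 n (addM A (diagM la)) r i k
    else 0.

(* Right action of the affine symmetric group: (i w)_k = i_{w(k)}. *)
Definition actI (n r : nat) (i : seq int) (w : int -> int) : seq int :=
  mkseq (fun m => extI n i (w (Posz m.+1))) r.

(* X_r lies in S_Delta(n,r) = End_{Q S_{Delta,r}}(Omega^{\otimes r}):   *)
(* it is a linear endomorphism (columns finite) commuting with the right *)
(* action omega_i |-> omega_{i w} (written out on matrix coefficients).  *)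
Definition inS (n r : nat) (X : Op) : Prop :=
  (forall j : seq int, size j = r ->
     exists s : seq (seq int), forall i, size i = r -> X r i j != 0 -> i \in s) /\
  (forall w : int -> int, bijective w -> (forall k, w (k + r%:Z) = w k + r%:Z) ->
     forall i j, size i = r -> size j = r ->
       X r (actI n r i w) (actI n r j w) = X r i j).

Definition comboA (n : nat)
  (s : seq (rat * ((int -> int -> nat) * (int -> nat)))) : Op :=
  fun r i k => \sum_(t <- s) t.1 * Aj n t.2.1 t.2.2 r i k.

Definition validAj (n : nat) (p : (int -> int -> nat) * (int -> nat)) : Prop :=
  ThetaPM n p.1 /\ NnD n p.2.

Definition inSpan (n : nat) (X : Op) : Prop :=
  exists s : seq (rat * ((int -> int -> nat) * (int -> nat))),
    (forall t, List.In t s -> validAj n t.2) /\ X = comboA n s.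

(* The loop algebra, basis E_{i,j} (1<=i<=n, j in Z); a generator (a,b)  *)
(* with a : 'I_n stands for E_{a+1,b}.                                    *)
Definition gen (n : nat) := ('I_n * int)%type.

Definition Emat (n : nat) (g : gen n) : int -> int -> rat :=
  fun x z => let a := (Posz g.1.+1) in let b := g.2 in
    ((n%:Z %| (x - a))%Z && (z - x == b - a))%:R.

(* coefficient of E_h in the commutator [E_g1, E_g2] = E_g1 E_g2 - E_g2 E_g1 *)
Definition brk (n : nat) (g1 g2 h : gen n) : rat :=
  let x := (Posz h.1.+1) in let y := h.2 in
  \sum_(z \in [set: int])
     (Emat n g1 x z * Emat n g2 z y - Emat n g2 x z * Emat n g1 z y).

(* Tensor algebra T(L) = free algebra on the basis: finite formal        *)
(* combinations of words in the generators.                              *)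
Definition TL (n : nat) := seq (rat * seq (gen n)).

Definition tcoef (n : nat) (p : TL n) (w : seq (gen n)) : rat :=
  \sum_(t <- p | t.2 == w) t.1.

(* coefficient of w in  u (g1 g2 - g2 g1 - [g1,g2]) v *)
Definition relcoef (n : nat) (d : seq (gen n) * gen n * gen n * seq (gen n))
  (w : seq (gen n)) : rat :=
  let: (u, g1, g2, v) := d in
  (w == u ++ g1 :: g2 :: v)%:R - (w == u ++ g2 :: g1 :: v)%:R -
  (match drop (size u) w with
   | h :: _ => if w == u ++ h :: v then brk n g1 g2 h else 0
   | [::] => 0
   end).

(* p lies in the two-sided ideal I with U(L) = T(L)/I *)
Definition inIdeal (n : nat) (p : TL n) : Prop :=
  exists q : seq (rat * (seq (gen n) * gen n * gen n * seq (gen n))),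
    forall w, tcoef n p w = \sum_(t <- q) t.1 * relcoef n t.2 w.

(* eta_r on generators: natural action of E_{a,b} on Omega^{\otimes r} *)
Definition etaCond (n : nat) (g : gen n) (i j : seq int) (s : nat) : bool :=
  let a := (Posz g.1.+1) in let b := g.2 in
  (n%:Z %| (nth 0 j s - b))%Z && (i == set_nth 0 j s (a + (nth 0 j s - b))).

Definition etaE (n : nat) (g : gen n) : Op :=
  fun r i j =>
    if (size i == r) && (size j == r) then
      (\sum_(s < r) (etaCond n g i j s : nat))%N%:R
    else 0.

Definition etaW (n : nat) (w : seq (gen n)) : Op := foldr (fun g acc => mulOp (etaE n g) acc) IdOp w.
Definition etaT (n : nat) (p : TL n) : Op :=
  fun r i k => \sum_(t <- p) t.1 * etaW n t.2 r i k.

(* Main.v *)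
Require Import Defs.
From HB Require Import structures.
From mathcomp Require Import all_boot all_order all_algebra.
From mathcomp Require Import boolp classical_sets fsbigop.
From mathcomp Require Import zify ring.
From Stdlib Require List.
Set Implicit Arguments.
Unset Strict Implicit.
Unset Printing Implicit Defensive.
Import Order.TTheory GRing.Theory Num.Theory.
Local Open Scope ring_scope.

(** Every operator involved depends, in its coefficient at [(i, k)], only on the
    list of classes of the pairs [(i_s, k_s)] modulo [(n, n)], so all statements
    become statements about functions of a word in the generators [E_{a,b}].
    On such functions let [lact g] be left multiplication by [E_g] and [extract h]
    the operator summing over the ways to delete one letter [h].  Then
    [lact g o extract h = extract h o lact g + extract (g h)], the [extract]s commute,
    and [lact g] and [extract g] agree on the identity operator.  Hence the
    normal-ordered products [normal w] (apply the letters of [w] at pairwise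
    distinct tensor positions) depend on [w] up to permutation only, and
    [eta w = normal w + shorter terms].  Likewise [A[j]] is a nonzero multiple of
    [normal w], where [w] has letter multiplicities [A] off the diagonal and [j] on
    it, plus shorter terms.  The functions [normal w] are linearly independent,
    since [normal w] vanishes at every word that does not contain [w] as a
    sub-multiset and is positive at [w].  So [eta w] and [A[j]] have the same span
    and the [A[j]] are a basis of it.  Finally, modulo the ideal each word is its
    sorted form plus shorter words, so comparing the terms of top length shows
    that the kernel of [eta] is the ideal. *)

Lemma big_pred1_uniq (R : Type) (idx : R) (op : Monoid.com_law idx) (I : eqType)
    (r : seq I) (x : I) (F : I -> R) : uniq r -> x \in r ->
  \big[op/idx]_(i <- r | i == x) F i = F x.
Proof.
move=> r_uniq xr; rewrite big_mkcond (bigD1_seq x) //= eqxx big1 ?Monoid.mulm1 //.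
by move=> i /negPf ->.
Qed.

(** * Linear spans of families of rational functions *)

Section LinearSpan.
Variable T : Type.
Implicit Types phi psi : T -> rat.

(** Given inductively so that linear operators pass through by induction on the combination;
    [span_seq] converts to explicit finite lists. *)
Inductive span (X : Type) (B : X -> T -> rat) (V : X -> Prop) : (T -> rat) -> Prop :=
| span0 : span B V (fun=> 0)
| span_cons a x phi : V x -> span B V phi ->
    span B V (fun t => a * B x t + phi t).

Definition linop (F : (T -> rat) -> T -> rat) := forall a phi psi t,
  F (fun s => a * phi s + psi s) t = a * F phi t + F psi t.

Lemma linop0 F t : linop F -> F (fun=> 0) t = 0.
Proof.
(* With scalar -1 and both arguments zero, linearity reads F 0 = - F 0 + F 0. *)
move=> linF; have := linF (-1) (fun=> 0) (fun=> 0) t.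
rewrite (_ : (fun _ => _) = (fun=> 0)); last by apply/funext => ?; rewrite mulr0 add0r.
by rewrite mulN1r addNr.
Qed.

Lemma linopZ F a phi t : linop F -> F (fun s => a * phi s) t = a * F phi t.
Proof.
move=> linF; rewrite -[RHS]addr0 -(linop0 t linF) -linF; congr (F _ t).
by apply/funext => s; rewrite addr0.
Qed.

Lemma span_add X B V phi psi :
  @span X B V phi -> span B V psi -> span B V (fun t => phi t + psi t).
Proof.
elim=> [|a x f Vx _ IH] Spsi.
  by rewrite (_ : (fun _ => _) = psi) //; apply/funext => t; rewrite add0r.
rewrite (_ : (fun _ => _) = fun t => a * B x t + (f t + psi t)).
  by apply: span_cons Vx (IH Spsi).
by apply/funext => t; rewrite addrA.
Qed.

Lemma span_linop X B V X' (B' : X' -> T -> rat) V' F phi : linop F ->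
  (forall x, V x -> span B' V' (F (B x))) -> @span X B V phi -> span B' V' (F phi).
Proof.
move=> linF FB; elim=> [|a x f Vx _ IH].
  by rewrite (_ : F _ = fun=> 0); [apply: span0 | apply/funext => t; apply: linop0].
rewrite (_ : F _ = fun t => a * F (B x) t + F f t); last exact/funext.
apply: span_add IH.
elim: (FB x Vx) => [|b y g Vy _ IH].
  by rewrite (_ : (fun _ => _) = fun=> 0); [apply: span0 | apply/funext => t; rewrite mulr0].
rewrite (_ : (fun _ => _) = fun t => (a * b) * B' y t + a * g t).
  exact: span_cons.
by apply/funext => t; rewrite mulrDr mulrA.
Qed.

Lemma span_trans X B V X' (B' : X' -> T -> rat) V' phi :
  (forall x, V x -> span B' V' (B x)) -> @span X B V phi -> span B' V' phi.
Proof. by apply: (@span_linop _ _ _ _ _ _ id). Qed.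

Lemma span_scale X B V a phi : @span X B V phi -> span B V (fun t => a * phi t).
Proof.
apply: (span_linop (F := fun f t => a * f t)) => [b f g t|x Vx].
  by rewrite mulrDr mulrCA.
rewrite (_ : (fun _ => _) = fun t => a * B x t + 0).
  by apply: span_cons Vx (span0 _ _).
by apply/funext => t; rewrite addr0.
Qed.

Lemma span_gen X (B : X -> T -> rat) (V : X -> Prop) x : V x -> span B V (B x).
Proof.
move=> Vx; rewrite (_ : B x = fun t => 1 * B x t + 0).
  by apply: span_cons Vx (span0 _ _).
by apply/funext => t; rewrite mul1r addr0.
Qed.

Lemma span_mono X (B : X -> T -> rat) (V V' : X -> Prop) phi :
  (forall x, V x -> V' x) -> span B V phi -> span B V' phi.
Proof. by move=> VV'; apply: span_trans => x /VV'; apply: span_gen. Qed.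

Lemma span_seq X (B : X -> T -> rat) (V : X -> Prop) phi : span B V phi <->
  exists s : seq (rat * X), (forall t, List.In t s -> V t.2) /\
    phi = fun u => \sum_(t <- s) t.1 * B t.2 u.
Proof.
split=> [|[s [Vs ->]]].
  elim=> [|a x f Vx _ [s [Vs ->]]].
    by exists [::]; split=> //; apply/funext => u; rewrite big_nil.
  exists ((a, x) :: s); split=> [t [<- //|/Vs //]|].
  by apply/funext => u; rewrite big_cons.
elim: s Vs => [|t s IH] Vs.
  rewrite (_ : (fun _ => _) = fun=> 0); first exact: span0.
  by apply/funext => u; rewrite big_nil.
rewrite (_ : (fun _ => _) = fun u => t.1 * B t.2 u + \sum_(t' <- s) t'.1 * B t'.2 u).
  apply: span_cons; first by apply: Vs; left.
  by apply: IH => t' t's; apply: Vs; right.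
by apply/funext => u; rewrite big_cons.
Qed.

End LinearSpan.

(** * Functions of words in the generators: deletion and left multiplication *)

Section WordFunctions.
Variable m : nat.
Local Notation n := m.+1.
Local Notation G := (gen n).
Local Notation word := (seq G).
Implicit Types (g h : G) (w tau sigma : word) (phi psi : word -> rat).

(* [x = (md x).+1 + n * qt x], with [md x] counted from 0. *)
Definition qt (x : int) : int := ((x - 1) %/ n%:Z)%Z.
Definition md (x : int) : 'I_n := inord `|((x - 1) %% n%:Z)%Z|%N.
Definition isdiag g := g.2 == (Posz g.1.+1).

Lemma mdE x : Posz (md x).+1 = x - n%:Z * qt x.
Proof.
have h0 : n%:Z != 0 by [].
rewrite -addn1 PoszD /md inordK; last first.
  rewrite -ltz_nat gez0_abs ?modz_ge0 //; exact: ltz_pmod.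
rewrite gez0_abs ?modz_ge0 // /qt /modz; ring.
Qed.

Lemma qt_md_unique (x q : int) (a : 'I_n) : x = Posz a.+1 + n%:Z * q -> qt x = q /\ md x = a.
Proof.
move=> xE.
have qE : qt x = q.
  rewrite /qt xE -addn1 PoszD.
  rewrite (_ : _ - 1 = q * n%:Z + a%:Z); last by ring.
  by rewrite divzMDl // divz_small ?addr0 //= ltz_nat ltn_ord.
split=> //; apply/val_inj/eqP; rewrite -eqSS -eqz_nat mdE qE xE; apply/eqP; ring.
Qed.

Lemma int_md_qt x : x = Posz (md x).+1 + n%:Z * qt x.
Proof. by rewrite mdE; ring. Qed.

Lemma qt_shift x q : qt (x + n%:Z * q) = qt x + q.
Proof.
have xE : x + n%:Z * q = Posz (md x).+1 + n%:Z * (qt x + q) by rewrite {1}(int_md_qt x); ring.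
by case: (qt_md_unique xE).
Qed.

Lemma md_shift x q : md (x + n%:Z * q) = md x.
Proof.
have xE : x + n%:Z * q = Posz (md x).+1 + n%:Z * (qt x + q) by rewrite {1}(int_md_qt x); ring.
by case: (qt_md_unique xE).
Qed.

Lemma qt_ord (a : 'I_n) : qt (Posz a.+1) = 0.
Proof. by have [] := @qt_md_unique (Posz a.+1) 0 a _; first by rewrite mulr0 addr0. Qed.

Lemma md_ord (a : 'I_n) : md (Posz a.+1) = a.
Proof. by have [] := @qt_md_unique (Posz a.+1) 0 a _; first by rewrite mulr0 addr0. Qed.

(* The class of the matrix position [(x, y)] modulo [(n, n)], written as the
   generator [E_{a,b}] whose support is that class. *)
Definition typ (x y : int) : G := (md x, y - n%:Z * qt x).

(* If [i_s] is congruent to the row index of [E_g], then [E_g] at position [s]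
   maps a sequence [i'] to [i] with [i_s' = i_s - (g.1 + 1) + g.2]; on classes, the
   pair at [s] passes from [t] to [act g t]. *)
Definition act g (t : G) : G := typ g.2 t.2.

(** The matrix product of the periodic elementary matrices [E_g] and [E_h], which is a single basis
    matrix or zero; [None] stands for zero. *)
Definition mulgen g h : option G :=
  if md g.2 == h.1 then Some (g.1, h.2 + n%:Z * qt g.2) else None.

(** The only class that [E_g] can turn into [h] is that of the product of [E_g] and [E_h], and there
    is none when this product vanishes. *)
Lemma act_eq g h (t : G) :
  (t.1 == g.1) && (act g t == h) = if mulgen g h is Some k then t == k else false.
Proof.
rewrite /mulgen /act /typ; case: t h g => [t1 t2] [h1 h2] [g1 g2] /=.
rewrite !xpair_eqE /=; case: (md g2 == h1) => //=; last by rewrite andbF.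
by rewrite subr_eq.
Qed.

(** Acting twice at one tensor position is acting once by the matrix product. Classes are changed on
    the row side, so [g] is applied before [h]. *)
Lemma act_act g h (t : G) : t.1 = g.1 ->
  (if (act g t).1 == h.1 then Some (act h (act g t)) else None) =
  if mulgen g h is Some k then Some (act k t) else None.
Proof.
move=> tg; rewrite /mulgen /act /typ /=; case: eqP => // _; congr Some.
by rewrite md_shift qt_shift; congr pair; ring.
Qed.

Lemma mulgen_fst g h k : mulgen g h = Some k -> k.1 = g.1.
Proof. by rewrite /mulgen; case: eqP => // _ [<-]. Qed.

(** Letters already passed are absorbed into the function argument, so one recursion visits every
    position; [lact] follows the same pattern. *)
Fixpoint extract h phi tau : rat :=
  if tau is t :: tau' then
    (t == h)%:R * phi tau' + extract h (fun sigma => phi (t :: sigma)) tau'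
  else 0.

Fixpoint lact g phi tau : rat :=
  if tau is t :: tau' then
    (t.1 == g.1)%:R * phi (act g t :: tau') + lact g (fun sigma => phi (t :: sigma)) tau'
  else 0.

Definition extract_opt (o : option G) phi tau := if o is Some k then extract k phi tau else 0.
Definition lact_opt (o : option G) phi tau := if o is Some k then lact k phi tau else 0.

(* Coefficients of the identity operator. *)
Definition vac tau : rat := (all isdiag tau)%:R.
Definition normal w : word -> rat := foldr extract vac w.
Definition eta_fun w : word -> rat := foldr lact vac w.

Lemma extract_lin h : linop (extract h).
Proof.
move=> a phi psi tau; elim: tau phi psi => [|t tau IH] phi psi /=.
  by rewrite mulr0 addr0.
by rewrite IH; ring.
Qed.

Lemma lact_lin g : linop (lact g).
Proof.
move=> a phi psi tau; elim: tau phi psi => [|t tau IH] phi psi /=.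
  by rewrite mulr0 addr0.
by rewrite IH; ring.
Qed.

Lemma extract_ext h phi psi tau :
  (forall sigma, perm_eq tau (h :: sigma) -> phi sigma = psi sigma) ->
  extract h phi tau = extract h psi tau.
Proof.
elim: tau phi psi => //= t tau IH phi psi E; congr (_ + _).
  by case: eqP => [th|_]; rewrite ?mul0r // E ?th.
apply: IH => sigma tausigma; apply: E.
rewrite (perm_trans (y := t :: h :: sigma)) ?perm_cons //.
by rewrite (perm_catCA [:: t] [:: h] sigma).
Qed.

Lemma extract_const h phi c tau :
  (forall sigma, perm_eq tau (h :: sigma) -> phi sigma = c) ->
  extract h phi tau = (count_mem h tau)%:R * c.
Proof.
move=> phic; rewrite (extract_ext (psi := fun=> c)) //.
by elim: tau {phic} => [|t tau IH] /=; rewrite ?mul0r // IH natrD mulrDl.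
Qed.

(** Both sides sum over pairs of distinct positions of [tau], one carrying [g] and the other [h]. *)
Lemma extract_comm g h phi tau : extract g (extract h phi) tau = extract h (extract g phi) tau.
Proof.
elim: tau phi => //= t tau IH phi.
rewrite (extract_lin g (t == h)%:R phi (extract h (fun s => phi (t :: s)))).
rewrite (extract_lin h (t == g)%:R phi (extract g (fun s => phi (t :: s)))).
by rewrite IH addrCA.
Qed.

(** Action and deletion at distinct positions commute. At a common position the letter must be
    turned into [h] by [E_g], and by [act_eq] this deletes the letter of the product. *)
Lemma lact_extract_comm g h phi tau :
  lact g (extract h phi) tau = extract h (lact g phi) tau + extract_opt (mulgen g h) phi tau.
Proof.
elim: tau phi => [|t tau IH] phi /=; first by rewrite add0r; case: mulgen.
rewrite (lact_lin g (t == h)%:R phi (extract h (fun s => phi (t :: s)))).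
rewrite (extract_lin h (t.1 == g.1)%:R (fun s => phi (act g t :: s)) (lact g (fun s =>
  phi (t :: s)))).
rewrite IH.
have := act_eq g h t; rewrite /extract_opt; case: (mulgen g h) => [k|] /= E.
  by rewrite -E -mulnb natrM; ring.
by have : ((t.1 == g.1) && (act g t == h))%:R = 0 :> rat;
  [rewrite E | rewrite -mulnb natrM => {}E; rewrite mulrDr mulrA E; ring].
Qed.

(** Contributions of two distinct positions cancel. Those of a single position are the two matrix
    products, so [lact] represents the commutator bracket. *)
Lemma lact_comm g h phi tau :
  lact g (lact h phi) tau - lact h (lact g phi) tau =
  lact_opt (mulgen g h) phi tau - lact_opt (mulgen h g) phi tau.
Proof.
have actE g1 h1 t sigma psi :
    (t.1 == g1.1)%:R * ((act g1 t).1 == h1.1)%:R * psi (act h1 (act g1 t) :: sigma) =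
    if mulgen g1 h1 is Some k then (t.1 == k.1)%:R * psi (act k t :: sigma) else 0.
  case: (t.1 =P g1.1) => [tg|/eqP tg].
    have := act_act h1 tg; case E: (mulgen g1 h1) => [k|]; case: ifP => // _.
      by move=> /Some_inj ->; rewrite (mulgen_fst E) tg eqxx !mul1r.
    by rewrite mulr0 mul0r.
  by case E: mulgen => [k|]; rewrite ?(mulgen_fst E) ?(negPf tg) !mul0r.
elim: tau phi => [|t tau IH] phi /=; first by case: mulgen => [?|]; case: mulgen.
rewrite (lact_lin g (t.1 == h.1)%:R (fun s => phi (act h t :: s)) (lact h (fun s => phi (t :: s)))).
rewrite (lact_lin h (t.1 == g.1)%:R (fun s => phi (act g t :: s)) (lact g (fun s => phi (t :: s)))).
have := IH (fun s => phi (t :: s)); have := actE g h t tau phi; have := actE h g t tau phi.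
set a := lact g _ tau; set b := lact h _ tau; set c := lact g _ tau; set d := lact h _ tau.
rewrite /lact_opt; case: (mulgen g h) => [k|]; case: (mulgen h g) => [k'|] /= E1 E2 E3;
  rewrite ?mulrDr ?mulrA ?E1 ?E2 -/a -/b;
  move: E3; move/(canRL (subrK _)) => ->; ring.
Qed.

(** [vac] requires diagonal letters, and [E_g] turns a letter into a diagonal one exactly when that
    letter is [g]; a deletion has the same effect on [vac]. *)
Lemma lact_vac g tau : lact g vac tau = extract g vac tau.
Proof.
elim: tau => //= t tau IH.
have vacE s : (fun sigma => vac (s :: sigma)) = fun sigma => (isdiag s)%:R * vac sigma + 0.
  by apply/funext => sigma; rewrite /vac /= -mulnb natrM addr0.
rewrite !vacE lact_lin extract_lin IH !linop0; try exact: lact_lin; try exact: extract_lin.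
congr (_ + _); rewrite [vac (_ :: _)]/vac /= -mulnb natrM mulrA -natrM mulnb; congr (_%:R * _).
congr nat_of_bool.
rewrite /isdiag /act /typ /= mdE subr_eq subrK.
by case: t g {IH} => [? ?] [? ?]; rewrite xpair_eqE eq_sym; congr andb; rewrite eq_sym.
Qed.

Lemma normal_perm w w' : perm_eq w w' -> normal w = normal w'.
Proof.
have move_cons h a b : normal (h :: a ++ b) = normal (a ++ h :: b).
  elim: a => //= x a IH; rewrite -IH /=; apply/funext => tau; exact: extract_comm.
elim: w w' => [|h w IH] w' pw; first by move: (perm_size pw); case: w' {pw}.
have hw' : h \in w' by rewrite -(perm_mem pw) mem_head.
case/splitPr: hw' pw => a b pw; rewrite -move_cons /= (IH (a ++ b)) //.
by rewrite -(perm_cons h) (perm_trans pw) // (perm_catCA a [:: h] b).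
Qed.

(** * The degree filtration and the leading term of [eta_fun] *)

Definition shorter d := span normal (fun w => (size w < d)%N).

Lemma extract_shorter h d phi : shorter d phi -> shorter d.+1 (extract h phi).
Proof. by apply: span_linop => [|w wd];
  [apply: extract_lin | apply: (@span_gen _ _ normal _ (h :: w))]. Qed.

Lemma shorterW d d' phi : (d <= d')%N -> shorter d phi -> shorter d' phi.
Proof. by move=> dd'; apply: span_mono => w /leq_trans; apply. Qed.

(** Move [lact g] inward past the [extract]s until it meets [vac] and becomes [extract g]. Each
    commutator merges [g] with one letter of [w], which leaves a word of size [size w]. *)
Lemma lact_normal g w : exists2 psi, shorter (size w).+1 psi &
  forall tau, lact g (normal w) tau = normal (g :: w) tau + psi tau.
Proof.
elim: w => [|h w [psi Spsi E]].
  by exists (fun=> 0) => [|tau]; [apply: span0 | rewrite addr0; apply: lact_vac].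
exists (fun tau => extract h psi tau + extract_opt (mulgen g h) (normal w) tau).
  apply: span_add; first exact: extract_shorter.
  case: mulgen => [k|]; last exact: span0.
  by apply: (@span_gen _ _ normal _ (k :: w)).
move=> tau;
  rewrite /= lact_extract_comm (_ : lact g _ = fun s => 1 * extract g (normal w) s + psi s).
  by rewrite extract_lin extract_comm; ring.
by apply/funext => s; rewrite mul1r -E.
Qed.

Lemma lact_shorter g d phi : shorter d phi -> shorter d.+1 (lact g phi).
Proof.
apply: span_linop => [|w wd]; first exact: lact_lin.
have [psi Spsi E] := lact_normal g w;
  rewrite (_ : lact g _ = fun tau => normal (g :: w) tau + psi tau).
  by apply: span_add; [apply: (@span_gen _ _ normal _ (g :: w)) | apply: shorterW Spsi;
    apply: ltnW].
exact/funext.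
Qed.

Lemma eta_fun_normal w : exists2 psi, shorter (size w) psi & forall tau, eta_fun w tau =
  normal w tau + psi tau.
Proof.
elim: w => [|g w [psi Spsi E]]; first by exists (fun=> 0) => [|tau]; [apply: span0 | rewrite addr0].
have [psi' Spsi' E'] := lact_normal g w.
exists (fun tau => psi' tau + lact g psi tau).
  by apply: span_add => //; apply: lact_shorter.
move=> tau /=; rewrite (_ : eta_fun w = fun tau => 1 * normal w tau + psi tau).
  by rewrite lact_lin E' /=; ring.
by apply/funext => s; rewrite mul1r.
Qed.

(** * Linear independence of the normal-ordered products *)

Lemma extract_neq0 h phi tau : extract h phi tau != 0 ->
  exists2 sigma, perm_eq tau (h :: sigma) & phi sigma != 0.
Proof.
apply: contraNP => E; rewrite (extract_const (c := 0)) ?mulr0 // => sigma ts.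
by apply: contra_notP E => /eqP; exists sigma.
Qed.

Lemma normal_neq0 w tau : normal w tau != 0 -> exists d, perm_eq tau (w ++ d).
Proof.
elim: w tau => [|h w IH] tau /=; first by exists tau.
case/extract_neq0 => sigma ts /IH[d sd]; exists d.
by rewrite (perm_trans ts) // perm_cons.
Qed.

Lemma extract_ge0 h phi tau : (forall s, 0 <= phi s) -> 0 <= extract h phi tau.
Proof.
elim: tau phi => //= t tau IH phi phi0.
by rewrite addr_ge0 ?mulr_ge0 ?IH.
Qed.

Lemma normal_ge0 w tau : 0 <= normal w tau.
Proof. by elim: w tau => [|h w IH] tau; rewrite /= ?extract_ge0 // /vac; case: all. Qed.

(** Deleting the letters of [w] from front to back is one term of the sum, with value 1, and no term
    is negative. *)
Lemma normal_diag_gt0 w : 0 < normal w w.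
Proof.
elim: w => //= h w IH; rewrite eqxx mul1r ltr_wpDr // extract_ge0 // => s.
exact: (normal_ge0 w).
Qed.

(** A canonical representative of the permutation class; [pickle] supplies a total order on the
    generators. *)
Definition srt w : word := sort (fun g h => (pickle g <= pickle h)%N) w.

Lemma srtP w w' : reflect (srt w = srt w') (perm_eq w w').
Proof.
apply: perm_sortP => [g h|g h k|g h]; [exact: leq_total|exact: leq_trans|].
by rewrite -eqn_leq => /eqP/(pcan_inj pickleK).
Qed.

Lemma perm_srt w : perm_eq (srt w) w. Proof. exact/permEl/perm_sort. Qed.

(** Group the terms by sorted word: [F] is constant on each group and factors out of a sum of
    coefficients that vanishes. *)
Lemma class_sum (s : TL n) (P : pred word) (F : word -> rat) :
  (forall w w', perm_eq w w' -> P w = P w' /\ F w = F w') ->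
  (forall w, P w -> \sum_(t <- s | perm_eq t.2 w) t.1 = 0) ->
  \sum_(t <- s | P t.2) t.1 * F t.2 = 0.
Proof.
move=> inv cl0; pose U := undup [seq srt t.2 | t <- s].
transitivity (\sum_(t <- s | P t.2) \sum_(u <- U | u == srt t.2) t.1 * F t.2).
  rewrite big_seq_cond [RHS]big_seq_cond; apply: eq_bigr => t /andP[ts _].
  rewrite big_pred1_uniq ?undup_uniq // mem_undup.
  by apply/mapP; exists t.
rewrite (exchange_big_dep predT) //= big_seq big1 // => u.
rewrite mem_undup => /mapP[t0 _ uE].
have permE t : (u == srt t.2) = perm_eq t.2 u.
  by apply/eqP/idP => [->|/srtP ->]; rewrite 1?perm_sym ?perm_srt // uE; apply/srtP;
    rewrite perm_sym perm_srt.
transitivity (\sum_(t <- s | P u && perm_eq t.2 u) t.1 * F u).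
  apply: eq_big => [t|t /andP[_]]; rewrite permE; last by case/inv=> _ ->.
  by case E: perm_eq; rewrite ?andbF // (inv _ _ E).1.
rewrite -big_distrl /=; case Pu: (P u) => /=; first by rewrite cl0 ?mul0r.
by rewrite big_pred0_eq mul0r.
Qed.

(** Coefficients are only determined per permutation class, because [normal] is constant there.
    Induct on the size of [w] and evaluate the relation at [w] itself. *)
Lemma normal_indep (s : TL n) : (forall tau, \sum_(t <- s) t.1 * normal t.2 tau = 0) ->
  forall w, \sum_(t <- s | perm_eq t.2 w) t.1 = 0.
Proof.
move=> s0 w; have [k] := ubnP (size w); elim: k w => // k IH w /ltnSE wk.
have short0 : \sum_(t <- s | (size t.2 < size w)%N) t.1 * normal t.2 w = 0.
  apply: (class_sum (P := fun u => (size u < size w)%N) (F := fun u => normal u w)) =>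
    [u u' uu'|u uw].
    by rewrite (normal_perm uu') (perm_size uu').
  by apply: IH; apply: leq_trans uw wk.
have := s0 w; rewrite (bigID (fun t => perm_eq t.2 w)) /=.
rewrite [X in _ + X](_ : _ = 0) ?addr0; last first.
  (* A term outside the class of [w] that is nonzero at [w] is a proper sub-multiset of [w], hence
     shorter, and the shorter terms cancel by induction. *)
  rewrite -{}[RHS]short0 big_mkcond [RHS]big_mkcond; apply: eq_bigr => t _.
  have [tw|tw] /= := boolP (perm_eq t.2 w); first by rewrite (perm_size tw) ltnn.
  case: ltnP => // wt; apply/eqP; rewrite mulf_eq0; apply/orP; right.
  apply: contraNT tw => /normal_neq0[d wtd].
  move: wt; rewrite (perm_size wtd) size_cat -{2}[size t.2]addn0 leq_add2l leqn0 size_eq0.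
  by move/eqP => d0; rewrite d0 cats0 in wtd; rewrite perm_sym.
rewrite (eq_bigr (fun t => t.1 * normal w w)) => [|t /normal_perm -> //].
by rewrite -big_distrl /= => /eqP; rewrite mulf_eq0 (gt_eqF (normal_diag_gt0 w)) orbF => /eqP.
Qed.

(** * Functions with a leading word, and the coefficient functions of the [A[j]] *)

Definition triangular phi w := exists2 c : rat, c != 0 &
  exists2 psi, shorter (size w) psi & forall tau, phi tau = c * normal w tau + psi tau.

Lemma triangular_eta w : triangular (eta_fun w) w.
Proof.
exists 1 => //; have [psi Spsi E] := eta_fun_normal w; exists psi => // tau.
by rewrite mul1r E.
Qed.

(** A triangular system is inverted by induction on the degree: solve for the leading [normal w] and
    expand the shorter remainder. *)
Lemma triangular_span X (B : X -> word -> rat) (V : X -> Prop) :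
  (forall w, exists2 x, V x & triangular (B x) w) -> forall w, span B V (normal w).
Proof.
move=> triB w; have [k] := ubnP (size w); elim: k w => // k IH w /ltnSE wk.
have [x Vx [c c0 [psi Spsi E]]] := triB w.
rewrite (_ : normal w = fun tau => c^-1 * B x tau + (- c^-1) * psi tau); last first.
  by apply/funext => tau; rewrite E mulrDr mulrA mulVf // mul1r mulNr addrK.
apply: span_cons => //; apply: span_scale; apply: span_trans Spsi => u uw.
by apply: IH; apply: leq_trans uw wk.
Qed.

(** Among the indices with nonzero coefficient take one, [u0], whose leading word is longest.
    Nothing else in the relation lies in the permutation class of that word, which contradicts
    [normal_indep]. *)
Lemma triangular_indep d (c : 'I_d -> rat) (B : 'I_d -> word -> rat) (ld : 'I_d -> word) :
  (forall u, triangular (B u) (ld u)) ->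
  (forall u v, perm_eq (ld u) (ld v) -> u = v) ->
  (forall tau, \sum_u c u * B u tau = 0) -> forall u, c u = 0.
Proof.
move=> triB ldinj sum0 u1; apply/eqP/negPn/negP => cu1.
have [u0 cu0 u0max] := @arg_maxnP _ u1 (fun u => c u != 0) (fun u => size (ld u)) cu1.
have /choice[kB kBP] : forall u, exists ks : rat * TL n, [/\ ks.1 != 0,
    forall t, List.In t ks.2 -> (size t.2 < size (ld u))%N &
    forall tau, B u tau = ks.1 * normal (ld u) tau + \sum_(t <- ks.2) t.1 * normal t.2 tau].
  move=> u; have [k k0 [psi /span_seq[s [ss ->]] E]] := triB u.
  by exists (k, s); split.
(* The relation rewritten in terms of [normal]. Tails with zero coefficient are dropped, so every
   remaining tail word is shorter than [ld u0]. *)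
pose S : TL n := [seq (c u * (kB u).1, ld u) | u <- index_enum 'I_d] ++
  flatten [seq [seq (c u * t.1, t.2) | t <- (kB u).2] | u <- index_enum 'I_d & c u != 0].
have S0 tau : \sum_(t <- S) t.1 * normal t.2 tau = 0.
  rewrite -{}[RHS](sum0 tau) big_cat big_map /= big_flatten /= big_map big_filter.
  rewrite [X in _ + X]big_mkcond -big_split; apply: eq_bigr => u _ /=.
  have [_ _ ->] := kBP u; have [->|_] /= := eqVneq; first by rewrite !mul0r addr0.
  rewrite mulrDr mulrA; congr (_ + _); rewrite big_map big_distrr /=.
  by apply: eq_bigr => t _; rewrite mulrA.
have := normal_indep S0 (ld u0); rewrite big_cat big_map /=.
rewrite (big_pred1 u0); last by move=> u /=; apply/idP/eqP => [/ldinj|->].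
rewrite big_flatten /= big_map big_filter big1 ?addr0 => [|u cu].
  by apply/eqP; rewrite mulf_eq0 negb_or cu0; have [-> _ _] := kBP u0.
rewrite big_map big_seq_cond big_pred0 // => t /=; apply/negP => /andP[ts /perm_size st].
have [_ sh _] := kBP u.
have /sh : List.In t (kB u).2.
  elim: (kB u).2 ts => //= t' s' IHs; rewrite inE => /predU1P[->|/IHs]; by [left|right].
by rewrite st ltnNge (u0max u cu : _ <= _)%N.
Qed.

(** An occurrence of [g] in [tau] is either used by one of the letters [g] of [w] or left over.
    Deleting a leftover diagonal letter does not change [vac], so the leftover ones are counted by
    [normal (g :: w)]. *)
Lemma normal_diag g w tau : isdiag g ->
  (count_mem g tau)%:R * normal w tau = normal (g :: w) tau + (count_mem g w)%:R * normal w tau.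
Proof.
move=> gd; elim: w tau => [|h w IH] tau.
  rewrite mul0r addr0 /= (@extract_const _ _ (vac tau)) // => sigma ts.
  by rewrite /vac (perm_all _ ts) /= gd.
have -> : (count_mem g tau)%:R * normal (h :: w) tau =
    extract h (fun s =>
      (count_mem g s)%:R * normal w s) tau + (h == g)%:R * extract h (normal w) tau.
  rewrite addrC -extract_lin -[LHS]addr0 -(linop0 tau (extract_lin h)) -extract_lin.
  apply: extract_ext => sigma ts; rewrite -[in RHS]mulrDl addr0 (permP ts) /=.
  by rewrite natrD.
rewrite (_ : (fun s => _) = fun s =>
  1 * extract g (normal w) s + (count_mem g w)%:R * normal w s); last first.
  by apply/funext => s; rewrite IH mul1r.
rewrite extract_lin mul1r (linopZ _ _ _ (extract_lin h)) extract_comm -addrA -mulrDl /=;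
  congr (_ + _ * _).
by rewrite natrD addrC.
Qed.

(* The diagonal generator [E_{a+1,a+1}]. *)
Definition dg (a : 'I_n) : G := (a, Posz a.+1).

Lemma isdiag_dg a : isdiag (dg a). Proof. by rewrite /isdiag. Qed.

Lemma isdiagP g : isdiag g -> g = dg g.1.
Proof. by case: g => a b /eqP /= ->. Qed.

Definition same_off w tau : bool :=
  `[< forall g, ~~ isdiag g -> count_mem g w = count_mem g tau >].

(** The coefficient of [A[j]] when [w] has multiplicities [A] off the diagonal and [j] on it: the
    diagonal multiplicities of [tau] are the entries of lambda, and [0 ^+ 0] is 1 as required. *)
Definition power_fun w tau : rat :=
  (same_off w tau)%:R * \prod_(a < n) (count_mem (dg a) tau)%:R ^+ count_mem (dg a) w.

Lemma power_fun_nil : power_fun [::] = vac.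
Proof.
apply/funext => tau; rewrite /power_fun /vac big1 // mulr1; congr (nat_of_bool _)%:R.
apply/asboolP/allP => [off g gt|dt g gd].
  by apply: contraTT gt => /off E; rewrite -has_pred1 has_count -E.
apply/esym/count_memPn; exact: contra (dt g) gd.
Qed.

Lemma power_fun_diag g w tau : isdiag g ->
  power_fun (g :: w) tau = (count_mem g tau)%:R * power_fun w tau.
Proof.
move=> gd; rewrite /power_fun mulrCA; congr (_ * _).
  congr (nat_of_bool _)%:R; apply/asboolP/asboolP => off h hd; rewrite -(off h hd) /=.
    by case: eqP => [gh|//]; rewrite -gh gd in hd.
  by case: eqP => [gh|//]; rewrite -gh gd in hd.
rewrite (bigD1 g.1) //= [in RHS](bigD1 g.1) //= mulrA {1}[in LHS](isdiagP gd) -(isdiagP gd) eqxx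
  exprS.
congr (_ * _); apply: eq_bigr => a ag; congr (_ ^+ _).
by rewrite (isdiagP gd) /dg xpair_eqE eq_sym (negPf ag).
Qed.

(** All deletions of [g] from [tau] give the same value, and where this value is nonzero [tau] has
    exactly one more [g] than [w]. *)
Lemma power_fun_off g w tau : ~~ isdiag g ->
  extract g (power_fun w) tau = (count_mem g w).+1%:R * power_fun (g :: w) tau.
Proof.
move=> gd; rewrite (@extract_const _ _ (power_fun (g :: w) tau)) => [|sigma ts].
  rewrite /power_fun /same_off; case: asboolP => [off|_]; last by rewrite mul0r !mulr0.
  by rewrite -(off g gd) /= eqxx.
have gE h : ((g == h) + count_mem h sigma = count_mem h tau)%N by rewrite (permP ts).
rewrite /power_fun; congr (_ * _).
  congr (nat_of_bool _)%:R; apply/asboolP/asboolP => off h hd; have := off h hd; rewrite -gE /=.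
    by move=> ->.
  by move/addnI.
apply: eq_bigr => a _; have ga : (g == dg a) = false.
  by apply: contraNF gd => /eqP ->; apply: isdiag_dg.
by rewrite -gE /= ga.
Qed.

(** A diagonal letter multiplies by a count, which [normal_diag] resolves; an off-diagonal one is an
    [extract] divided by its new multiplicity. The leading scalar is thus the inverse product of the
    factorials of the off-diagonal multiplicities. *)
Lemma triangular_power w : triangular (power_fun w) w.
Proof.
elim: w => [|g w [c c0 [psi Spsi E]]].
  by rewrite power_fun_nil; exists 1 => //; exists (fun=> 0) => [|tau];
    [apply: span0 | rewrite mul1r addr0].
have [gd|gd] := boolP (isdiag g).
  exists c => //;
    exists (fun tau => c * (count_mem g w)%:R * normal w tau + (count_mem g tau)%:R * psi tau).
    apply: span_add; first by apply: span_scale; apply: span_gen => /=.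
    apply: (span_linop (F := fun f tau => (count_mem g tau)%:R * f tau)) Spsi => [a f f' tau|u uw].
      by rewrite mulrDr mulrCA.
    rewrite (_ : (fun _ => _) = fun tau => normal (g :: u) tau + (count_mem g u)%:R * normal u tau).
      apply: span_add; first by apply: (@span_gen _ _ normal _ (g :: u)).
      by apply: span_scale; apply: span_gen; apply: leq_trans uw _.
    by apply/funext => tau; rewrite normal_diag.
  move=> tau; rewrite power_fun_diag // E mulrDr mulrCA normal_diag //; ring.
pose d : rat := (count_mem g w).+1%:R; have d0 : d != 0 by rewrite pnatr_eq0.
exists (d^-1 * c); first by rewrite mulf_neq0 ?invr_eq0.
exists (fun tau => d^-1 * extract g psi tau); first by apply: span_scale; apply: extract_shorter.
move=> tau; apply: (mulfI d0); rewrite -power_fun_off //.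
rewrite (_ : power_fun w = fun tau => c * normal w tau + psi tau); last exact/funext.
by rewrite extract_lin /= mulrDr !mulrA mulfV // !mul1r.
Qed.

End WordFunctions.

(** * Structure constants and formal combinations in the tensor algebra *)

Section Kernel.
Variable m : nat.
Local Notation n := m.+1.
Local Notation G := (gen n).
Local Notation word := (seq G).
Implicit Types (g h : G) (u v w tau : word) (p q : TL n).

Lemma dvdz_md x (a : 'I_n) : (n%:Z %| x - Posz a.+1)%Z = (md m x == a).
Proof.
apply/idP/eqP => [/dvdzP[q xE]|<-].
  have xE' : x = Posz a.+1 + n%:Z * q by rewrite mulrC -xE; ring.
  by case: (qt_md_unique xE').
by rewrite {1}(int_md_qt m x) addrC addKr dvdz_mulr.
Qed.

Lemma EmatE g x z : Emat n g x z = (typ m x z == g)%:R.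
Proof.
rewrite /Emat dvdz_md /typ; case: g => a b /=; rewrite xpair_eqE; congr (nat_of_bool _)%:R.
case: (md m x =P a) => //= <-; rewrite mdE; apply/eqP/eqP; lia.
Qed.

Lemma typ_ord (a : 'I_n) y : typ m (Posz a.+1) y = (a, y).
Proof. by rewrite /typ md_ord qt_ord mulr0 subr0. Qed.

Lemma brkE g1 g2 h : brk n g1 g2 h = (mulgen g1 g2 == Some h)%:R - (mulgen g2 g1 == Some h)%:R.
Proof.
have termE k1 k2 z : Emat n k1 (Posz h.1.+1) z * Emat n k2 z h.2 =
    if z == k1.2 then (mulgen k1 k2 == Some h)%:R else 0.
  have -> : Emat n k1 (Posz h.1.+1) z = ((h.1 == k1.1) && (z == k1.2))%:R.
    by rewrite EmatE typ_ord; case: (k1).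
  rewrite EmatE -natrM mulnb.
  have := act_eq k1 k2 h; rewrite /act; case: (z =P k1.2) => [->|_]; rewrite ?andbF // andbT => ->.
  by case: mulgen => // k; rewrite (eq_sym h) (inj_eq Some_inj).
rewrite /brk; under eq_fsbigr do rewrite !termE.
(* Each of the two matrix products has at most one nonzero summand, at the column index of its left
   factor. *)
rewrite (fsbigE (undup [:: g1.2; g2.2])) ?undup_uniq // => [|z _]; last first.
  by rewrite mem_undup !inE negb_or => /andP[/negPf-> /negPf->]; rewrite subrr.
rewrite (eq_bigl predT) => [|z]; last by rewrite in_setT.
rewrite sumrB -!big_mkcond !big_pred1_uniq ?undup_uniq // mem_undup !inE eqxx ?orbT //.
Qed.

Definition scaleT (c : rat) p : TL n := [seq (c * t.1, t.2) | t <- p].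
Definition lmulT g p : TL n := [seq (t.1, g :: t.2) | t <- p].
Definition optT (c : rat) u (o : option G) v : TL n :=
  if o is Some k then [:: (c, u ++ k :: v)] else [::].
(** The relator as an element of the tensor algebra, with the bracket written as a difference of two
    matrix products; ideal membership becomes list arithmetic. *)
Definition relT (d : word * G * G * word) : TL n :=
  let: (u, g1, g2, v) := d in
  [:: (1, u ++ g1 :: g2 :: v), (-1, u ++ g2 :: g1 :: v) &
      optT (-1) u (mulgen g1 g2) v ++ optT 1 u (mulgen g2 g1) v].

Lemma tcoef_nil w : tcoef n [::] w = 0. Proof. exact: big_nil. Qed.

Lemma tcoef_cons t p w : tcoef n (t :: p) w = (t.2 == w)%:R * t.1 + tcoef n p w.
Proof. by rewrite /tcoef big_cons; case: eqP => _; rewrite ?mul1r // mul0r add0r. Qed.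

Lemma tcoef_cat p q w : tcoef n (p ++ q) w = tcoef n p w + tcoef n q w.
Proof. exact: big_cat. Qed.

Lemma tcoef_scale c p w : tcoef n (scaleT c p) w = c * tcoef n p w.
Proof. by rewrite /tcoef big_map big_distrr. Qed.

Lemma tcoef_flatten (I : Type) (s : seq I) (F : I -> TL n) w :
  tcoef n (flatten [seq F i | i <- s]) w = \sum_(i <- s) tcoef n (F i) w.
Proof. by elim: s => [|i s IH]; rewrite ?big_nil ?tcoef_nil // big_cons /= tcoef_cat IH. Qed.

Lemma tcoef_lmul g p w :
  tcoef n (lmulT g p) w = if w is h :: w' then (g == h)%:R * tcoef n p w' else 0.
Proof.
rewrite /tcoef big_map; case: w => [|h w]; first by rewrite big_pred0.
under eq_bigl do rewrite eqseq_cons.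
by case: eqP => _ /=; rewrite ?mul1r // big_pred0 // mul0r.
Qed.

Lemma relcoefE d w : relcoef n d w = tcoef n (relT d) w.
Proof.
case: d => [[[u g1] g2] v]; rewrite /relcoef /relT !tcoef_cons tcoef_cat /=.
rewrite !(eq_sym (u ++ _) w).
have optE c o : tcoef n (optT c u o v) w = c *
    match drop (size u) w with
    | h :: _ => if w == u ++ h :: v then (o == Some h)%:R else 0
    | [::] => 0
    end.
  case: o => [k|] /=.
    rewrite tcoef_cons tcoef_nil addr0 mulrC eq_sym /=; congr (_ * _).
    case: (w =P u ++ k :: v) => [->|wk]; first by rewrite drop_size_cat // !eqxx.
    case: drop => // h _; case: eqP => // wh; case: eqP => // -[kh]; by rewrite kh in wk.
  by rewrite tcoef_nil; case: drop => [|h _]; rewrite ?mulr0 //; case: ifP; rewrite mulr0.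
rewrite !optE; case: drop => [|h _]; first by rewrite !mulr0; ring.
by case: ifP => _; rewrite ?brkE; ring.
Qed.

Definition expandT (q : seq (rat * (word * G * G * word))) : TL n :=
  flatten [seq scaleT t.1 (relT t.2) | t <- q].

Lemma inIdealE p : inIdeal n p <-> exists r, tcoef n p =1 tcoef n (expandT r).
Proof.
by split=> -[q E]; exists q => w; rewrite E /expandT tcoef_flatten; apply: eq_bigr => t _;
  rewrite tcoef_scale relcoefE.
Qed.

Lemma sum_tcoef p (S : seq word) (f : word -> rat) : uniq S ->
  (forall t, t \in p -> t.2 \in S) ->
  \sum_(t <- p) t.1 * f t.2 = \sum_(w <- S) tcoef n p w * f w.
Proof.
move=> S_uniq pS; transitivity (\sum_(t <- p) \sum_(w <- S | w == t.2) t.1 * f w).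
  by rewrite big_seq [RHS]big_seq; apply: eq_bigr => t /pS tS; rewrite big_pred1_uniq.
rewrite (exchange_big_dep predT) //=; apply: eq_bigr => w _.
rewrite /tcoef big_distrl /=; apply: eq_bigl => t; exact: eq_sym.
Qed.

(** Linear functionals depend only on the coefficients, so representatives of the same tensor are
    interchangeable. *)
Lemma eq_tcoef_sum p q (f : word -> rat) : tcoef n p =1 tcoef n q ->
  \sum_(t <- p) t.1 * f t.2 = \sum_(t <- q) t.1 * f t.2.
Proof.
move=> pq; pose S := undup [seq t.2 | t <- p ++ q].
rewrite !(@sum_tcoef _ S) ?undup_uniq // => [|t tq|t tp].
- by apply: eq_bigr => w _; rewrite pq.
- by rewrite mem_undup map_f // mem_cat tq orbT.
- by rewrite mem_undup map_f // mem_cat tp.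
Qed.

(** * Evaluation of formal combinations and its vanishing on the ideal *)

Definition evalT p tau : rat := \sum_(t <- p) t.1 * eta_fun t.2 tau.

Lemma evalT_cat p q tau : evalT (p ++ q) tau = evalT p tau + evalT q tau.
Proof. exact: big_cat. Qed.

Lemma evalT_scale c p tau : evalT (scaleT c p) tau = c * evalT p tau.
Proof. by rewrite /evalT big_map big_distrr; apply: eq_bigr => t _; rewrite [RHS]mulrA. Qed.

Lemma evalT_flatten (I : Type) (s : seq I) (F : I -> TL n) tau :
  evalT (flatten [seq F i | i <- s]) tau = \sum_(i <- s) evalT (F i) tau.
Proof.
elim: s => [|i s IH]; first by rewrite /evalT !big_nil.
by rewrite big_cons /= evalT_cat IH.
Qed.

Lemma evalT_lmul g p tau : evalT (lmulT g p) tau = lact g (evalT p) tau.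
Proof.
elim: p => [|t p IH].
  rewrite /evalT big_nil (_ : (fun _ => _) = fun=> 0) ?linop0 //; first exact: lact_lin.
  by apply/funext => s; rewrite big_nil.
rewrite /= /evalT big_cons (_ : (fun _ => _) = fun s => t.1 * eta_fun t.2 s + evalT p s);
  last first.
  by apply/funext => s; rewrite big_cons.
by rewrite lact_lin -IH.
Qed.

Lemma relT_cons g u g1 g2 v : relT (g :: u, g1, g2, v) = lmulT g (relT (u, g1, g2, v)).
Proof. by rewrite /relT /=; case: mulgen => [k|]; case: mulgen. Qed.

(** The suffix [v] is absorbed into the function to which [lact_comm] applies; the prefix [u] is
    added letter by letter through the linear operators [lact]. *)
Lemma evalT_rel d tau : evalT (relT d) tau = 0.
Proof.
case: d => [[[u g1] g2] v]; elim: u tau => [|g u IH] tau.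
  rewrite /evalT /relT !big_cons big_cat /=.
  have optE c o : \sum_(t <- optT c [::] o v) t.1 * eta_fun t.2 tau =
    c * lact_opt o (eta_fun v) tau.
    by case: o => [k|] /=; rewrite ?big_seq1 // big_nil mulr0.
  by rewrite !optE mul1r !mulN1r mul1r addrA lact_comm; ring.
rewrite relT_cons evalT_lmul (_ : evalT _ = fun=> 0) ?linop0 //; [exact: lact_lin | exact/funext].
Qed.

Lemma evalT_ideal p tau : inIdeal n p -> evalT p tau = 0.
Proof.
case/inIdealE => q pq; rewrite /evalT (eq_tcoef_sum (fun w => eta_fun w tau) pq).
rewrite -/(evalT _ tau) /expandT evalT_flatten big1 // => t _.
by rewrite evalT_scale evalT_rel mulr0.
Qed.

(** * Reordering words modulo the ideal, and the kernel of the evaluation *)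

Lemma ideal_eq p q : tcoef n p =1 tcoef n q -> inIdeal n q -> inIdeal n p.
Proof. by move=> pq [r E]; exists r => w; rewrite pq E. Qed.

Lemma ideal_nil : inIdeal n [::].
Proof. by exists [::] => w; rewrite tcoef_nil big_nil. Qed.

Lemma ideal_cat p q : inIdeal n p -> inIdeal n q -> inIdeal n (p ++ q).
Proof. by move=> [r E] [r' E']; exists (r ++ r') => w; rewrite tcoef_cat E E' big_cat. Qed.

Lemma ideal_scale c p : inIdeal n p -> inIdeal n (scaleT c p).
Proof.
move=> [r E]; exists [seq (c * t.1, t.2) | t <- r] => w; rewrite tcoef_scale E big_map big_distrr.
by apply: eq_bigr => t _; rewrite [LHS]mulrA.
Qed.

Lemma ideal_flatten (I : Type) (s : seq I) (F : I -> TL n) :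
  (forall i, inIdeal n (F i)) -> inIdeal n (flatten [seq F i | i <- s]).
Proof. by move=> FI; elim: s => [|i s IH]; [apply: ideal_nil | apply: ideal_cat]. Qed.

Lemma ideal_lmul g p : inIdeal n p -> inIdeal n (lmulT g p).
Proof.
pose sh (d : word * G * G * word) := let: (u, g1, g2, v) := d in (g :: u, g1, g2, v).
have shE d : relT (sh d) = lmulT g (relT d) by case: d => [[[u g1] g2] v]; apply: relT_cons.
move=> [r E]; exists [seq (t.1, sh t.2) | t <- r] => w; rewrite tcoef_lmul big_map.
case: w => [|h w].
  by rewrite big1 // => t _; rewrite relcoefE shE tcoef_lmul mulr0.
rewrite E big_distrr; apply: eq_bigr => t _.
by rewrite !relcoefE shE tcoef_lmul [LHS]mulrCA.
Qed.

Lemma ideal_rel d : inIdeal n (relT d).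
Proof. by exists [:: (1, d)] => w; rewrite big_seq1 mul1r relcoefE. Qed.

(* [w = w'] modulo the ideal and shorter words. *)
Definition cong_lower w w' := exists2 q : TL n,
  forall t, t \in q -> (size t.2 < size w)%N & inIdeal n ((1, w) :: (-1, w') :: q).

Lemma cong_lower_refl w : cong_lower w w.
Proof.
exists [::] => //; apply: ideal_eq ideal_nil => u.
by rewrite !tcoef_cons /= tcoef_nil; ring.
Qed.

(** The two occurrences of [w'] cancel; equality of sizes keeps the second tail shorter than [w]. *)
Lemma cong_lower_trans w w' w'' : size w = size w' ->
  cong_lower w w' -> cong_lower w' w'' -> cong_lower w w''.
Proof.
move=> ww' [q qs qI] [q' qs' qI']; exists (q ++ q').
  by move=> t; rewrite mem_cat => /orP[/qs //|/qs']; rewrite ww'.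
apply: ideal_eq (ideal_cat qI qI') => u.
by rewrite !(tcoef_cat, tcoef_cons) /=; ring.
Qed.

Lemma cong_lower_cons g w w' : cong_lower w w' -> cong_lower (g :: w) (g :: w').
Proof.
move=> [q qs qI]; exists (lmulT g q); last exact: (ideal_lmul g qI).
by move=> t /mapP[t' /qs t'q ->].
Qed.

(** This is a relator with empty prefix, whose bracket terms are one letter shorter. *)
Lemma cong_lower_swap g h v : cong_lower (g :: h :: v) (h :: g :: v).
Proof.
exists (optT (-1) [::] (mulgen g h) v ++ optT 1 [::] (mulgen h g) v);
  last exact: (ideal_rel ([::], g, h, v)).
by move=> t; rewrite mem_cat => /orP[]; case: mulgen => //= k; rewrite inE => /eqP ->.
Qed.

Lemma cong_lower_perm w w' : perm_eq w w' -> cong_lower w w'.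
Proof.
have move_cons h a b : cong_lower (h :: a ++ b) (a ++ h :: b).
  elim: a => [|x a IH]; first exact: cong_lower_refl.
  by apply: cong_lower_trans (cong_lower_swap _ _ _) (cong_lower_cons x IH).
elim: w w' => [|h w IH] w' pw.
  by move: (perm_size pw); case: w' {pw} => // _; apply: cong_lower_refl.
have hw' : h \in w' by rewrite -(perm_mem pw) mem_head.
case/splitPr: hw' pw => a b pw.
have pw' : perm_eq w (a ++ b).
  by rewrite -(perm_cons h) (perm_trans pw) // (perm_catCA a [:: h] b).
apply: cong_lower_trans (cong_lower_cons h (IH _ pw')) (move_cons h a b).
by rewrite /= (perm_size pw').
Qed.

(** Replace each [eta_fun] by its [normal] plus shorter terms. For words of size at most [k] these
    corrections have size below [k], so independence in degree [k] sees only the coefficients of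
    [p]. *)
Lemma top_class_sum k p : (forall t, t \in p -> (size t.2 <= k)%N) ->
  (forall tau, evalT p tau = 0) ->
  forall w, size w = k -> \sum_(t <- p | perm_eq t.2 w) t.1 = 0.
Proof.
move=> pk p0 w wk.
have /choice[s sP] : forall u, exists s : TL n,
    (forall t, List.In t s -> (size t.2 < size u)%N) /\
    forall tau, eta_fun u tau = normal u tau + \sum_(t <- s) t.1 * normal t.2 tau.
  move=> u; have [psi /span_seq[s [ss ->]] E] := eta_fun_normal u; by exists s.
pose S : TL n := p ++ flatten [seq scaleT t.1 (s t.2) | t <- p].
have S0 tau : \sum_(t <- S) t.1 * normal t.2 tau = 0.
  rewrite big_cat /= big_flatten /= big_map -big_split /= -{}[RHS](p0 tau).
  apply: eq_bigr => t _; rewrite (sP t.2).2 mulrDr; congr (_ + _).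
  by rewrite big_map big_distrr; apply: eq_bigr => t' _; rewrite [RHS]mulrA.
have := normal_indep S0 w; rewrite big_cat /= [X in _ + X](_ : _ = 0) ?addr0 //.
rewrite big_flatten /= big_map big_seq big1 // => t /pk tk.
rewrite big_map big_seq_cond big_pred0 // => t'; apply/negP => /andP[t's /perm_size /=].
have /(sP t.2).1 t'lt : List.In t' (s t.2).
  elim: (s t.2) t's => //= t0 s' IHs; rewrite inE => /predU1P[->|/IHs]; by [left|right].
by move=> E; move: (leq_trans t'lt tk); rewrite E wk ltnn.
Qed.

(** Induction on a strict bound for the degree. Modulo the ideal [p] becomes a combination of sorted
    words plus shorter ones; its top-degree coefficients are class sums, hence zero, and the rest is
    again in the kernel of the evaluation. *)
Lemma ideal_evalT p : (forall tau, evalT p tau = 0) -> inIdeal n p.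
Proof.
have [k pk] : exists k, forall t, t \in p -> (size t.2 < k)%N.
  elim: p => [|t p [k IH]]; first by exists 0%N.
  exists (maxn (size t.2).+1 k) => t'; rewrite inE => /predU1P[->|/IH t'k].
    by rewrite leq_max leqnn.
  by rewrite leq_max t'k orbT.
elim: k p pk => [|k IH] p pk p0.
  by case: p pk {p0} => [|t p] pk; [apply: ideal_nil | have := pk t (mem_head _ _)].
have /choice[q qP] : forall w, exists q : TL n, (forall t, t \in q -> (size t.2 < size w)%N) /\
    inIdeal n ((1, w) :: (-1, srt w) :: q).
  by move=> w; have [|q] := @cong_lower_perm w (srt w); [rewrite perm_sym perm_srt | exists q].
(* As tensors, [p] is [I0 + sp + R]: [I0] lies in the ideal, [sp] is [p] with its words sorted, and
   [R] removes the tails; [low] omits the part of [sp] of degree [k]. *)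
pose I0 := flatten [seq scaleT t.1 ((1, t.2) :: (-1, srt t.2) :: q t.2) | t <- p].
pose R := flatten [seq scaleT (- t.1) (q t.2) | t <- p].
pose sp : TL n := [seq (t.1, srt t.2) | t <- p].
pose low := [seq t <- sp | (size t.2 < k)%N] ++ R.
have top0 w : size w = k -> tcoef n sp w = 0.
  move=> wk; rewrite /tcoef big_map /=.
  (* An unsorted word does not occur in [sp]; a sorted one collects its whole permutation class. *)
  have [ws|ws] := eqVneq (srt w) w; last first.
    rewrite big_pred0 // => t; apply: contraNF ws => /eqP <-; apply/eqP/srtP; exact: perm_srt.
  rewrite -[RHS](top_class_sum pk p0 wk); apply: eq_bigl => t.
  by apply/eqP/srtP; rewrite ws.
have spE w : tcoef n sp w = tcoef n [seq t <- sp | (size t.2 < k)%N] w.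
  rewrite {2}/tcoef big_filter_cond; have [wk|wk] := boolP (size w < k)%N.
    by apply: eq_bigl => t; case: eqP => [->|_]; rewrite ?wk ?andbF.
  rewrite [RHS]big_pred0 => [|t]; last by apply/negP => /andP[+ /eqP E]; rewrite E (negPf wk).
  have [|wk'] := eqVneq (size w) k; first exact: top0.
  rewrite /tcoef big_map big_seq_cond big_pred0 // => t; apply/negP => /andP[/pk tk /eqP /= E].
  by move: wk wk'; rewrite -E (perm_size (perm_srt _)); move: tk; rewrite ltnS; case: ltngtP.
(* The decomposition for a single term of [p] with coefficient [c]: [a] and [b] tell whether [w] is
   its word or its sorted word, and [x] is the coefficient of [w] in the tail. *)
have coefE (a b : bool) (c x : rat) : (if a then c else 0) =
    a%:R * (c * 1) + (b%:R * (c * -1) + c * x) + ((if b then c else 0) + - c * x).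
  by case: a b => -[] /=; rewrite ?mul1r ?mul0r; ring.
have pE : tcoef n p =1 tcoef n (I0 ++ low).
  move=> w; rewrite !tcoef_cat -spE /I0 /R !tcoef_flatten /sp /tcoef big_map /= big_mkcond.
  rewrite [X in _ = _ + (X + _)]big_mkcond -!big_split; apply: eq_bigr => t _ /=.
  rewrite -!/(tcoef n _ w) !tcoef_cons !tcoef_scale /=.
  exact: coefE.
have I0I : inIdeal n I0 by apply: ideal_flatten => t; apply: ideal_scale; apply: (qP t.2).2.
apply: (ideal_eq pE); apply: (ideal_cat I0I); apply: IH => [t|tau].
  rewrite mem_cat mem_filter => /orP[/andP[]//|/flattenP[x /mapP[t' t'p ->] /mapP[t'' t''q ->]]].
  by apply: leq_trans ((qP t'.2).1 _ t''q) _; rewrite -ltnS pk.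
have := p0 tau;
  rewrite /evalT (eq_tcoef_sum (fun w => eta_fun w tau) pE) -!/(evalT _ tau) evalT_cat.
by rewrite (evalT_ideal tau I0I) add0r.
Qed.

End Kernel.

(** * Operators on tensor space as functions of class words *)

Section Operators.
Variable m : nat.
Local Notation n := m.+1.
Local Notation G := (gen n).
Local Notation word := (seq G).
Implicit Types (g h : G) (u v w : word) (p q : TL n) (i k : seq int) (phi : word -> rat).

Lemma typ_shift x y (q : int) : typ m (x + n%:Z * q) (y + n%:Z * q) = typ m x y.
Proof. by rewrite /typ md_shift qt_shift; congr pair; ring. Qed.

Lemma isdiag_typ x y : isdiag (typ m x y) = (x == y).
Proof. by rewrite /isdiag /typ /= mdE (inj_eq (addIr _)) eq_sym. Qed.

Definition types i k : word := [seq typ m z.1 z.2 | z <- zip i k].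

Lemma size_types i k : size i = size k -> size (types i k) = size i.
Proof. by move=> ik; rewrite size_map size1_zip ?ik. Qed.

(** The generator [(a, b)] is the class of position [(a + 1, b)], so every word arises from a pair
    of sequences; this makes [lift] injective. *)
Lemma types_onto (tau : word) :
  types [seq Posz g.1.+1 | g <- tau] [seq g.2 | g <- tau] = tau.
Proof.
elim: tau => //= g tau IH; rewrite /types /= typ_ord -/(types _ _) IH.
by case: g.
Qed.

Definition lift phi : Op := fun r i k =>
  if (size i == r) && (size k == r) then phi (types i k) else 0.

Lemma lift_inj phi psi : lift phi = lift psi -> phi = psi.
Proof.
move=> E; apply/funext => tau.
have := congr1 (fun X => X (size tau) [seq Posz g.1.+1 | g <- tau] [seq g.2 | g <- tau]) E.
by rewrite /lift !size_map eqxx /= types_onto.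
Qed.

Lemma lift0 : lift (fun=> 0) = zeroOp.
Proof. by apply/funext => r; apply/funext => i; apply/funext => k; rewrite /lift if_same. Qed.

Lemma IdOpE : IdOp = lift (@vac m).
Proof.
apply/funext => r; apply/funext => i; apply/funext => k; rewrite /IdOp /lift.
case: (size i =P r) => //= ir; case: (size k =P r) => [kr|kr]; last first.
  by case: eqP => // ik; case: kr; rewrite -ik.
rewrite /vac /types all_map; congr (nat_of_bool _)%:R.
move: ir; rewrite -kr => {kr r}; elim: i k => [|x i IH] [|y k] //= [/IH ikE].
by rewrite eqseq_cons isdiag_typ ikE.
Qed.

Definition upd i s (c : int) : seq int := set_nth 0 i s (nth 0 i s + c).

Lemma size_upd i s c : (s < size i)%N -> size (upd i s c) = size i.
Proof. by move=> si; rewrite size_set_nth; apply/maxn_idPr. Qed.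

Lemma updK i s c : (s < size i)%N -> upd (upd i s c) s (- c) = i.
Proof.
move=> si; apply: (@eq_from_nth _ 0); first by rewrite !size_upd // size_upd.
by move=> t _; rewrite !nth_set_nth /= !nth_set_nth /= eqxx; case: eqP => [->|//]; rewrite addrK.
Qed.

(** The condition is turned around to give [j] in terms of [i], since in a product the row index [i]
    is fixed and [j] is summed over. *)
Lemma etaCondE g i j s : (s < size i)%N -> size i = size j -> etaCond n g i j s =
  (md m (nth 0 i s) == g.1) && (j == upd i s (g.2 - Posz g.1.+1)).
Proof.
move=> si ij; have sj : (s < size j)%N by rewrite -ij.
set a := Posz g.1.+1; set b := g.2.
have -> : etaCond n g i j s = (n%:Z %| nth 0 j s - b)%Z && (i == upd j s (a - b)).
  by rewrite /etaCond /upd; congr (_ && (i == set_nth _ _ _ _)); rewrite -/a -/b; ring.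
have -> : (i == upd j s (a - b)) = (j == upd i s (b - a)).
  apply/eqP/eqP => ->; [rewrite -[b - a]opprB | rewrite -[a - b]opprB]; by rewrite updK.
rewrite andbC [RHS]andbC; case: eqP => //= ->.
rewrite nth_set_nth /= eqxx -dvdz_md; congr (_ %| _)%Z; rewrite -/a; ring.
Qed.

(** The sum in [mulOp] defaults to 0 on an infinite support, so products are computed through a
    finite list covering the row. *)
Lemma mulOpE (X Y : Op) r i k (S : seq (seq int)) : uniq S ->
  (forall j, X r i j != 0 -> j \in S) ->
  mulOp X Y r i k = \sum_(j <- S) X r i j * Y r j k.
Proof.
move=> S_uniq XS; rewrite /mulOp (fsbigE S) // => [|j _ jS].
  by apply: eq_bigl => j; rewrite in_setT.
by apply/eqP; rewrite mulf_eq0; apply/orP; left; apply: contraNT jS => /XS.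
Qed.

Lemma mulOp_etaE g (X : Op) r i k : mulOp (etaE n g) X r i k =
  if size i == r then
    \sum_(s < r) (md m (nth 0 i s) == g.1)%:R * X r (upd i s (g.2 - Posz g.1.+1)) k
  else 0.
Proof.
case: (size i =P r) => [ir|/eqP ir]; last first.
  by rewrite /mulOp fsbig1 // => j _; rewrite /etaE (negPf ir) mul0r.
(* All possible middle sequences. For [c = 0] different positions give the same one, hence the
   [undup]; multiplicities are kept by [eE]. *)
set c := g.2 - _; pose S := undup [seq upd i s c | s : 'I_r].
have inS s : upd i (s : 'I_r) c \in S by rewrite mem_undup; apply/mapP; exists s; rewrite ?mem_enum.
have eE j : etaE n g r i j =
    \sum_(s < r) (md m (nth 0 i s) == g.1)%:R * (j == upd i s c)%:R.
  rewrite /etaE ir eqxx /=; case: (size j =P r) => [jr|jr].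
    rewrite natr_sum; apply: eq_bigr => s _; rewrite etaCondE ?ir ?jr //.
    by rewrite -natrM mulnb.
  rewrite big1 // => s _; case: (j =P _) => [jE|_]; last by rewrite mulr0.
  by case: jr; rewrite jE size_upd ?ir.
rewrite (@mulOpE _ _ _ _ _ S) ?undup_uniq //; last first.
  move=> j; apply: contraNT => jS; rewrite eE big1 // => s _.
  by case: (j =P _) => [jE|_]; [rewrite jE inS in jS | rewrite mulr0].
under eq_bigr do rewrite eE big_distrl.
rewrite exchange_big /=; apply: eq_bigr => s _.
under eq_bigr do rewrite -mulrA.
rewrite -big_distrr /=; congr (_ * _).
rewrite -[RHS](@big_pred1_uniq _ _ +%R _ S (upd i s c) (fun j => X r j k)) ?undup_uniq //.
rewrite [RHS]big_mkcond; apply: eq_bigr => j _.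
by case: eqP; rewrite ?mul1r ?mul0r.
Qed.

Lemma mulOp_lift g phi : mulOp (etaE n g) (lift phi) = lift (lact g phi).
Proof.
apply/funext => r; apply/funext => i; apply/funext => k; rewrite mulOp_etaE /lift.
case: (size i =P r) => //= ir; case: (size k =P r) => [kr|kr]; last first.
  by rewrite big1 // => s _; rewrite andbF mulr0.
under eq_bigr => s _ do rewrite size_upd ?ir // eqxx /=.
rewrite -{}ir in kr *; elim: i k kr phi => [|x i IH] [|y k] // kr phi; first by rewrite big_ord0.
rewrite big_ord_recl /= -IH; last by case: kr.
congr (_ + _); case: (md m x =P g.1) => [xg|_]; last by rewrite !mul0r.
(* Here [x] is [g.1 + 1] plus a multiple of [n]; shifting both coordinates by that multiple
   identifies the class after the update with [act g]. *)
congr (_ * phi (_ :: _)); rewrite /act /= -[RHS](typ_shift _ _ (qt m x)); congr typ; last by ring.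
by rewrite {1}(int_md_qt m x) xg; ring.
Qed.

Lemma etaWE w : etaW n w = lift (eta_fun w).
Proof. by elim: w => [|g w IH] /=; rewrite ?IdOpE // IH mulOp_lift. Qed.

Lemma etaTE p : etaT n p = lift (evalT p).
Proof.
apply/funext => r; apply/funext => i; apply/funext => k; rewrite /etaT /lift /evalT.
case: ifP => E; first by apply: eq_bigr => t _; rewrite etaWE /lift E.
by rewrite big1 // => t _; rewrite etaWE /lift E mulr0.
Qed.

(** Finite rows make the sums in products genuine finite sums. *)
Lemma etaW_row_finite w r i :
  exists S : seq (seq int), forall j, etaW n w r i j != 0 -> j \in S.
Proof.
elim: w i => [|g w IH] i.
  exists [:: i] => j /=; by rewrite /IdOp inE (eq_sym j); case: (i == j); rewrite ?andbF ?eqxx.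
have /choice[S SP] := fun s : 'I_r => IH (upd i s (g.2 - Posz g.1.+1)).
exists (flatten [seq S s | s : 'I_r]) => j; rewrite /= mulOp_etaE; case: (size i == r);
  last by rewrite eqxx.
apply: contraNT => jS; rewrite big1 // => s _.
apply/eqP; rewrite mulf_eq0; apply/orP; right; apply: contraNT jS => /SP jS.
by apply/flattenP; exists (S s) => //; apply/mapP; exists s; rewrite ?mem_enum.
Qed.

(** Finite columns are the endomorphism condition in [inS]; the possible rows are recovered by
    undoing the update made by the first letter. *)
Lemma etaW_col_finite w r k :
  exists S : seq (seq int), forall i, size i = r -> etaW n w r i k != 0 -> i \in S.
Proof.
elim: w => [|g w [S SP]].
  by exists [:: k] => i _ /=; rewrite /IdOp inE; case: (i == k); rewrite ?andbF ?eqxx.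
exists [seq upd j s (Posz g.1.+1 - g.2) | j <- S, s <- iota 0 r] => i ir.
rewrite /= mulOp_etaE ir eqxx; apply: contraNT => iS; rewrite big1 // => s _.
have si : (s < size i)%N by rewrite ir.
apply/eqP; rewrite mulf_eq0; apply/orP; right; apply: contraNT iS => /SP jS.
apply/allpairsP; exists (upd i s (g.2 - Posz g.1.+1), val s); split=> /=.
- by apply: jS; rewrite size_upd.
- by rewrite mem_iota /= add0n ltn_ord.
- by rewrite -[X in upd _ _ X]opprB updK.
Qed.

(** Rows of both left factors are finite, so the two sums may be interchanged for arbitrary [Y]. *)
Lemma mulOp_assoc g w (Y : Op) :
  mulOp (mulOp (etaE n g) (etaW n w)) Y = mulOp (etaE n g) (mulOp (etaW n w) Y).
Proof.
apply/funext => r; apply/funext => i; apply/funext => k; rewrite mulOp_etaE.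
case: (size i =P r) => [ir|/eqP ir]; last first.
  by rewrite {1}/mulOp fsbig1 // => j _; rewrite mulOp_etaE (negPf ir) mul0r.
have /choice[S SP] := fun s : 'I_r => etaW_row_finite w r (upd i s (g.2 - Posz g.1.+1)).
pose T := undup (flatten [seq S s | s : 'I_r]).
have SPT s j : etaW n w r (upd i s (g.2 - Posz g.1.+1)) j != 0 -> (s < r)%N -> j \in T.
  move=> + sr; move/(SP (Ordinal sr)) => jS; rewrite mem_undup.
  by apply/flattenP; exists (S (Ordinal sr)) => //; apply/mapP; exists (Ordinal sr);
    rewrite ?mem_enum.
rewrite (@mulOpE _ _ _ _ _ T) ?undup_uniq //; last first.
  move=> j; rewrite mulOp_etaE ir eqxx; apply: contraNT => jT; rewrite big1 // => s _.
  apply/eqP; rewrite mulf_eq0; apply/orP; right; apply: contraNT jT => /SPT; exact.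
under eq_bigr do rewrite mulOp_etaE ir eqxx big_distrl.
rewrite exchange_big /=; apply: eq_bigr => s _.
rewrite (@mulOpE _ _ _ _ _ T) ?undup_uniq //; last by move=> j /SPT; apply.
by rewrite big_distrr; apply: eq_bigr => j _; rewrite [RHS]mulrA.
Qed.

Lemma mulOp_Id phi : mulOp IdOp (lift phi) = lift phi.
Proof.
apply/funext => r; apply/funext => i; apply/funext => k.
rewrite (@mulOpE _ _ _ _ _ [:: i]) // => [|j]; last first.
  by rewrite /IdOp inE (eq_sym j); case: (i == j); rewrite ?andbF ?eqxx.
by rewrite big_seq1 /IdOp /lift eqxx andbT; case: (size i == r); rewrite ?mul1r ?mul0r.
Qed.

Lemma mulOp_etaW w q : mulOp (etaW n w) (etaT n q) = etaT n (foldr (@lmulT m) q w).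
Proof.
elim: w => [|g w IH]; first by rewrite /= etaTE mulOp_Id.
rewrite /= mulOp_assoc IH !etaTE mulOp_lift; congr lift; apply/funext => tau.
by rewrite evalT_lmul.
Qed.

(** The concatenation product of the tensor algebra. *)
Definition mulT p q : TL n := flatten [seq scaleT t.1 (foldr (@lmulT m) q t.2) | t <- p].

Lemma mulOp_etaT p q : mulOp (etaT n p) (etaT n q) = etaT n (mulT p q).
Proof.
apply/funext => r; apply/funext => i; apply/funext => k.
have /choice[S SP] := fun w => etaW_row_finite w r i.
pose T := undup (flatten [seq S t.2 | t <- p]).
have ST t j : t \in p -> etaW n t.2 r i j != 0 -> j \in T.
  move=> tp /SP jS; rewrite mem_undup; apply/flattenP; exists (S t.2) => //.
  by apply/mapP; exists t.
rewrite (@mulOpE _ _ _ _ _ T) ?undup_uniq //; last first.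
  move=> j; apply: contraNT => jT; rewrite /etaT big1_seq // => t /andP[_ tp].
  by apply/eqP; rewrite mulf_eq0; apply/orP; right; apply: contraNT jT => /(ST _ _ tp).
transitivity (\sum_(t <- p) t.1 * mulOp (etaW n t.2) (etaT n q) r i k).
  under eq_bigr do rewrite {1}/etaT big_distrl.
  rewrite exchange_big /= big_seq [RHS]big_seq; apply: eq_bigr => t tp.
  rewrite (@mulOpE _ _ _ _ _ T) ?undup_uniq //; last by move=> j; apply: ST.
  by rewrite big_distrr; apply: eq_bigr => j _; rewrite [RHS]mulrA.
rewrite /mulT /etaT big_flatten /= big_map; apply: eq_bigr => t _.
rewrite mulOp_etaW /etaT big_map big_distrr; apply: eq_bigr => t' _.
by rewrite [LHS]mulrA.
Qed.

End Operators.

(** * Positions of elements under [List.In] and [List.NoDup] *)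

Lemma In_nth (X : Type) (x0 : X) s x : List.In x s -> exists2 u, (u < size s)%N & nth x0 s u = x.
Proof.
elim: s => //= y s IH [->|/IH[u us <-]]; first by exists 0%N.
by exists u.+1.
Qed.

Lemma nth_In (X : Type) (x0 : X) s u : (u < size s)%N -> List.In (nth x0 s u) s.
Proof. by elim: s u => //= y s IH [|u] /=; [left | right; apply: IH]. Qed.

Lemma NoDup_nth_inj (X : Type) (x0 : X) s : List.NoDup s ->
  forall u v, (u < size s)%N -> (v < size s)%N -> nth x0 s u = nth x0 s v -> u = v.
Proof.
elim=> //= y {}s ys _ IH [|u] [|v] //= us vs E.
- by case: ys; rewrite E; apply: nth_In.
- by case: ys; rewrite -E; apply: nth_In.
- by rewrite (IH u v).
Qed.

(** * Coefficients of [A[j]] and words with prescribed multiplicities *)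

Section SpanOfAj.
Variable m : nat.
Local Notation n := m.+1.
Local Notation G := (gen n).
Local Notation word := (seq G).
Implicit Types (g h : G) (u v w T : word) (i k : seq int).
Implicit Types (A : int -> int -> nat) (j la : int -> nat).

Lemma periodic_step (X : Type) (f : int -> X) (c : int) :
  (forall x, f (x + c) = f x) -> forall x q, f (x + c * q) = f x.
Proof.
move=> fc; have fnat x (q : nat) : f (x + c * q%:Z) = f x.
  elim: q x => [|q IH] x; first by rewrite mulr0 addr0.
  by rewrite -[RHS]IH -[RHS]fc; congr f; rewrite -addn1 PoszD; ring.
move=> x [q|q]; first exact: fnat.
by rewrite -[LHS](fnat _ q.+1); congr f; rewrite NegzE; ring.
Qed.

Lemma extIE i (l : nat) s : size i = l.+1 ->
  extI n i s = nth 0 i (md l s) + n%:Z * qt l s.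
Proof.
move=> il; rewrite /extI il /qt /md inordK //.
by rewrite -ltz_nat gez0_abs ?modz_ge0 //; apply: ltz_pmod.
Qed.

Lemma count_types g i k : size i = size k ->
  count_mem g (types m i k) = (\sum_(s < size i) (typ m (nth 0%R i s) (nth 0%R k s) == g))%N.
Proof.
elim: i k => [|x i IH] [|y k] //= => [_|[/IH ikE]]; first by rewrite big_ord0.
by rewrite big_ord_recl /= ikE.
Qed.

Lemma MmatE i k : size i = size k ->
  Mmat n i k = fun x y => count_mem (typ m x y) (types m i k).
Proof.
move=> ik; apply/funext => x; apply/funext => y; rewrite count_types // /Mmat.
case ir: (size i) => [|l] /=; first by rewrite big_ord0.
(* Moving a position by the length moves both sequences by [n]. Hence each residue [s] has a single
   translate, [f s], at which the first sequence can take the value [x]. *)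
pose f (s : 'I_l.+1) : int := Posz s.+1 + l.+1%:Z * (qt m x - qt m (nth 0 i s)).
have mdf s : md l (f s) = s by case: (@qt_md_unique l (f s) _ s erefl).
have qtf s : qt l (f s) = qt m x - qt m (nth 0 i s) by case: (@qt_md_unique l (f s) _ s erefl).
rewrite (fsbigE [seq f s | s : 'I_l.+1]) //.
- rewrite (eq_bigl predT) => [|z]; last by rewrite in_setT.
  rewrite big_map big_enum; apply: eq_bigr => s _.
  rewrite !(@extIE _ l) // -?ik // mdf qtf; congr nat_of_bool.
  rewrite /typ xpair_eqE; apply/andP/andP => -[/eqP E1 /eqP E2]; split; apply/eqP.
  + by rewrite -E1 md_shift.
  + by rewrite -E2; ring.
  + by rewrite {1}(int_md_qt m (nth 0 i s)) E1 {3}(int_md_qt m x); ring.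
  + by move/(canRL (subrK _)): E2 => ->; ring.
- by rewrite map_inj_uniq ?enum_uniq // => s t /(congr1 (md l)); rewrite !mdf.
- move=> s _; apply: contraNeq; rewrite -lt0n lt0b => /andP[/eqP E _].
  apply/mapP; exists (md l s); first by rewrite mem_enum.
  by rewrite /f -E (extIE s ir) qt_shift addrAC subrr add0r -int_md_qt.
Qed.

Lemma sum_count_dg T : (\sum_(a < n) count_mem (dg a) T)%N = count (@isdiag m) T.
Proof.
elim: T => [|t T IH] /=; first by rewrite big1.
rewrite big_split /= IH; congr addn; have [td|td] := boolP (isdiag t).
  rewrite (bigD1 t.1) //= {1}(isdiagP td) eqxx big1 // => a at1.
  by rewrite (isdiagP td) /dg xpair_eqE eq_sym (negPf at1).
by rewrite big1 // => a _; case: eqP => // ta; rewrite ta isdiag_dg in td.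
Qed.

Lemma sum_count_types T :
  (\sum_(a < n) \big[addn/0%N]_(l \in [set: int]) count_mem (a, l) T)%N = size T.
Proof.
pose S := undup [seq t.2 | t <- T].
transitivity (\sum_(a < n) \sum_(l <- S) count_mem (a, l) T)%N.
  apply: eq_bigr => a _; rewrite (fsbigE S) ?undup_uniq //.
    by apply: eq_bigl => l; rewrite in_setT.
  move=> l _ lS; apply/count_memPn; apply: contra lS => aT.
  by rewrite mem_undup; apply/mapP; exists (a, l).
have : forall t, t \in T -> t.2 \in S by move=> t tT; rewrite mem_undup; apply: map_f.
have : uniq S by apply: undup_uniq.
move: S => S S_uniq; elim: T => [|t T IH] TS /=; first by rewrite big1 // => a _; rewrite big1.
under eq_bigr do rewrite big_split.
rewrite big_split /= IH => [|t' t'T]; last by apply: TS; rewrite inE t'T orbT.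
rewrite (bigD1 t.1) //= (bigD1_seq t.2) ?TS ?mem_head //= -surjective_pairing eqxx.
rewrite !big1 // => [a at1|l lt2]; last by case: (t) lt2 => x y;
  rewrite xpair_eqE eq_sym => /negPf ->; rewrite andbF.
by rewrite big1 // => l _; case: (t) at1 => x y; rewrite xpair_eqE eq_sym => /negPf ->.
Qed.

Definition powerAj (z : (int -> int -> nat) * (int -> nat)) T : rat :=
  `[< forall g, ~~ isdiag g -> z.1 (Posz g.1.+1) g.2 = count_mem g T >]%:R *
  \prod_(a < n) (count_mem (dg a) T)%:R ^+ z.2 (Posz a.+1).

Definition has_counts (z : (int -> int -> nat) * (int -> nat)) w :=
  (forall g, ~~ isdiag g -> count_mem g w = z.1 (Posz g.1.+1) g.2) /\
  (forall a, count_mem (dg a) w = z.2 (Posz a.+1)).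

Lemma powerAjE z w : has_counts z w -> powerAj z = power_fun w.
Proof.
move=> [offw diagw]; apply/funext => T; rewrite /powerAj /power_fun; congr (_ * _).
  congr (nat_of_bool _)%:R; apply: asbool_equiv_eq.
  by split=> E g gd; rewrite -E // offw.
by apply: eq_bigr => a _; rewrite diagw.
Qed.

Lemma ThetaPM_typ A x y : ThetaPM n A -> A x y = A (Posz (typ m x y).1.+1) (typ m x y).2.
Proof.
move=> [Aper _]; pose f c := A (Posz (typ m x y).1.+1 + c) ((typ m x y).2 + c).
have step c : f (c + n%:Z) = f c by rewrite /f !addrA Aper.
by have := periodic_step step 0 (qt m x); rewrite /f add0r !addr0 /= -int_md_qt subrK.
Qed.

Lemma NnD_typ j x : NnD n j -> j x = j (Posz (md m x).+1).
Proof. by move=> jper; rewrite {1}(int_md_qt m x) periodic_step. Qed.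

(** Periodicity recovers [A] and [j] from their values at class representatives, and the diagonal of
    [A] is zero. *)
Lemma has_counts_inj z z' w w' : validAj n z -> validAj n z' ->
  has_counts z w -> has_counts z' w' -> perm_eq w w' -> z = z'.
Proof.
case: z z' => [A j] [A' j'] [/= TA Nj] [/= TA' Nj'] [/= offA diagA] [/= offA' diagA'] /permP ww'.
congr pair; apply/funext => x; last first.
  by rewrite (NnD_typ _ Nj) (NnD_typ _ Nj') -diagA -diagA' ww'.
apply/funext => y; have [->|xy] := eqVneq x y.
  by case: TA TA' => _ [-> _] [_ [-> _]].
rewrite (ThetaPM_typ _ _ TA) (ThetaPM_typ _ _ TA') -offA -?offA' ?isdiag_typ ?ww' //.
Qed.

(** As [A] has zero diagonal, [la] can only be the sequence of diagonal multiplicities; at most one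
    lambda contributes to a given coefficient of [A[j]]. *)
Lemma addM_diag_eq A la i k : ThetaPM n A -> size i = size k ->
  Mmat n i k = addM A (diagM la) <->
  (forall g, ~~ isdiag g -> A (Posz g.1.+1) g.2 = count_mem g (types m i k)) /\
  la = fun x => count_mem (dg (md m x)) (types m i k).
Proof.
have typxx x : typ m x x = dg (md m x) by rewrite /typ /dg mdE.
move=> TA ik; rewrite MmatE //; split=> [E|[off ->]].
  have {}E x y : count_mem (typ m x y) (types m i k) = (A x y + diagM la x y)%N.
    by have := congr1 (fun f => f x y) E.
  split=> [g gd|].
    have := E (Posz g.1.+1) g.2; rewrite typ_ord -surjective_pairing => ->.
    by rewrite /diagM; case: eqP => [gE|_]; [rewrite /isdiag -gE eqxx in gd | rewrite addn0].
  by apply/funext => x; rewrite -typxx E /diagM eqxx; case: TA => _ [-> _].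
apply/funext => x; apply/funext => y; rewrite /addM /diagM.
have [<-|xy] := eqVneq x y; first by case: TA => _ [-> _]; rewrite typxx.
by rewrite addn0 (ThetaPM_typ _ _ TA) off // isdiag_typ.
Qed.

(** The word splits into off-diagonal letters, counted by [sigmaA], and diagonal ones. This puts the
    only contributing lambda into [LambdaD n (r - sigmaA n A)]. *)
Lemma sigmaA_off A T : ThetaPM n A ->
  (forall g, ~~ isdiag g -> A (Posz g.1.+1) g.2 = count_mem g T) ->
  (sigmaA n A + \sum_(a < n) count_mem (dg a) T = size T)%N.
Proof.
move=> TA off; pose T' := [seq t <- T | ~~ isdiag t].
rewrite sum_count_dg -(count_predC (@isdiag m) T) addnC; congr addn.
rewrite -size_filter -/T' -(sum_count_types T'); apply: eq_bigr => a _.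
apply: eq_fsbigr => l _; rewrite /T' count_filter.
have [ald|ald] := boolP (isdiag ((a, l) : G)).
  rewrite (@eq_count _ _ pred0) ?count_pred0; last first.
    by move=> t /=; apply/negP => /andP[/eqP ->]; rewrite ald.
  by move/eqP: ald => /= ->; case: TA => _ [].
rewrite (off (a, l)) //; apply: eq_count => t /=; case: eqP => [->|//]; by rewrite ald.
Qed.

Lemma AjE A j : validAj n (A, j) -> Aj n A j = lift (powerAj (A, j)).
Proof.
move=> [/= TA Nj]; apply/funext => r; apply/funext => i; apply/funext => k.
rewrite /Aj /lift /Abr1; case: (size i =P r) => /= [ir|_]; last first.
  by case: ifP => // _; rewrite fsbig1 // => la _; rewrite mulr0.
case: (size k =P r) => /= [kr|_]; last first.
  by case: ifP => // _; rewrite fsbig1 // => la _; rewrite mulr0.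
have ik : size i = size k by rewrite ir.
rewrite /powerAj /=; case: asboolP => [off|noff]; last first.
  rewrite mul0r; case: ifP => // _; rewrite fsbig1 // => la _.
  by case: asboolP => [/(addM_diag_eq la TA ik)[]//|_]; rewrite mulr0.
pose la0 x := count_mem (dg (md m x)) (types m i k).
have sz := sigmaA_off TA off; rewrite size_types // ir in sz.
rewrite -{1}sz leq_addr (fsbigE [:: la0]) //.
- rewrite big_mkcond big_seq1 ifT.
    rewrite asboolT; last by apply/(addM_diag_eq la0 TA ik).
    rewrite mulr1 mul1r /lampow natr_prod; apply: eq_bigr => a _.
    by rewrite natrX /la0 md_ord.
  rewrite inE; split=> [x|]; first by rewrite /la0 -{1}[n%:Z]mulr1 md_shift.
  by rewrite -[in RHS]sz addKn; apply: eq_bigr => a _; rewrite /la0 md_ord.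
- move=> la /=; rewrite inE => /eqP ->; split=> [x|];
    first by rewrite /la0 -{1}[n%:Z]mulr1 md_shift.
  by rewrite -[in RHS]sz addKn; apply: eq_bigr => a _; rewrite /la0 md_ord.
- move=> la _; rewrite inE => lane; case: asboolP => [|_]; last by rewrite mulr0.
  by case/(addM_diag_eq la TA ik) => _ laE; rewrite laE eqxx in lane.
Qed.

Lemma word_has_counts w : exists2 z, validAj n z & has_counts z w.
Proof.
exists (fun x y => if x == y then 0%N else count_mem (typ m x y) w,
        fun x => count_mem (dg (md m x)) w).
  split=> /=; last by move=> x; rewrite -{1}[n%:Z]mulr1 md_shift.
  split=> [x y|].
    by rewrite (inj_eq (addIr _)) -{1 2}[n%:Z]mulr1 typ_shift.
  split=> [x|x]; first by rewrite eqxx.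
  (* In row [x], the class of [g] meets column [g.2 + n * qt x]; a bound over the letters of [w]
     gives row finiteness. *)
  have [B BP] : exists B, forall g, g \in w -> (`|(g.2 + n%:Z * qt m x)%R| <= B)%N.
    elim: w => [|g w [B IH]]; first by exists 0%N.
    exists (maxn `|(g.2 + n%:Z * qt m x)%R|%N B) => h; rewrite inE => /predU1P[->|/IH hB].
      by rewrite leq_max leqnn.
    by rewrite leq_max hB orbT.
  exists B => y yB; case: eqP => // _; apply/count_memPn; apply: contraL yB => /BP.
  by rewrite /typ /= subrK -leqNgt.
split=> [g gd|a] /=; last by rewrite md_ord.
rewrite typ_ord -surjective_pairing; case: eqP => // E.
by rewrite /isdiag -E eqxx in gd.
Qed.

Lemma count_flatten_nseq (X : eqType) (S : seq X) (c : X -> nat) x : uniq S ->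
  count_mem x (flatten [seq nseq (c y) y | y <- S]) = if x \in S then c x else 0%N.
Proof.
elim: S => //= y S IH /andP[yS /IH E]; rewrite count_cat E count_nseq inE /=.
case: (eqVneq x y) => [->|xy] /=; first by rewrite ?eqxx mul1n (negPf yS) addn0.
by rewrite ?(negPf xy) mul0n.
Qed.

Lemma has_counts_word z : validAj n z -> exists w, has_counts z w.
Proof.
case: z => A j [/= TA Nj].
have /choice[B BP] : forall a : 'I_n, exists B : nat,
    forall l : int, (B < `|l|)%N -> A (Posz a.+1) l = 0%N.
  by move=> a; case: TA => _ [_]; apply.
(* The maximum covers the nonzero entries of [A] in rows 1 to [n], and the summand [n] covers the
   diagonal letters. *)
pose M := (n + \max_(a < n) B a)%N.
pose Z := [seq Posz l | l <- iota 0 M.+1] ++ [seq - Posz l | l <- iota 0 M.+1].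
have ZP (l : int) : (`|l| <= M)%N -> l \in Z.
  move=> lM; rewrite mem_cat; apply/orP; case: l lM => l lM; [left | right].
    by apply/mapP; exists l; rewrite ?mem_iota.
  by apply/mapP; exists l.+1; rewrite ?mem_iota ?NegzE.
pose S : word := undup [seq (a, l) | a <- enum 'I_n, l <- Z].
have SP g : (`|g.2| <= M)%N -> g \in S.
  move=> gM; rewrite mem_undup; apply/allpairsP; exists (g.1, g.2).
  by rewrite mem_enum ZP -?surjective_pairing.
pose c g := if isdiag g then j g.2 else A (Posz g.1.+1) g.2.
exists (flatten [seq nseq (c g) g | g <- S]); split=> [g gd|a] /=;
  rewrite count_flatten_nseq ?undup_uniq //.
  rewrite /c (negPf gd); case: ifP => // gS; apply/esym/BP.
  rewrite ltnNge; apply: contraFN gS => gB; apply: SP; apply: leq_trans gB _.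
  by rewrite /M; apply: leq_trans (leq_addl _ _); apply: leq_bigmax.
by rewrite SP /c ?isdiag_dg //= /M; apply: leq_trans (ltn_ord a) (leq_addr _ _).
Qed.

(** * Equality of the two spans, equivariance and independence *)

Lemma triangular_powerAj z w : has_counts z w -> triangular (powerAj z) w.
Proof. by move/powerAjE ->; apply: triangular_power. Qed.

Lemma comboAE s : (forall t, List.In t s -> validAj n t.2) ->
  comboA n s = lift (fun T => \sum_(t <- s) t.1 * powerAj t.2 T).
Proof.
move=> sV; apply/funext => r; apply/funext => i; apply/funext => k.
rewrite /comboA /lift; elim: s sV => [|t s IH] sV; first by rewrite !big_nil if_same.
rewrite !big_cons IH; last by move=> t' t's; apply: sV; right.
have -> : Aj n t.2.1 t.2.2 = lift (powerAj t.2).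
  by rewrite AjE -?surjective_pairing //; apply: sV; left.
by rewrite /lift; case: ifP => // _; rewrite mulr0 addr0.
Qed.

Lemma inSpanE X : inSpan n X <-> exists2 phi, span powerAj (validAj n) phi & X = lift phi.
Proof.
split=> [[s [sV ->]]|[phi /span_seq[s [sV ->]] ->]].
  by rewrite comboAE //; exists (fun T => \sum_(t <- s) t.1 * powerAj t.2 T) => //;
    apply/span_seq; exists s.
by exists s; split=> //; rewrite comboAE.
Qed.

(** Both families are triangular over the [normal] functions and every word is a leading word of
    each, so either family expands in the other through [normal]; [inSpan_image] is the converse
    direction. *)
Lemma inSpan_etaT p : inSpan n (etaT n p).
Proof.
apply/inSpanE; exists (evalT p); last exact: etaTE.
have : span (@eta_fun m) (fun=> True) (evalT p) by apply/span_seq; exists p.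
apply: span_trans => w _; have [psi Spsi E] := eta_fun_normal w.
have normal_span u : span powerAj (validAj n) (normal u).
  apply: triangular_span => {}u; have [z zV zu] := word_has_counts u.
  by exists z => //; apply: triangular_powerAj.
rewrite (_ : eta_fun w = fun tau => normal w tau + psi tau); last exact/funext.
by apply: span_add => //; apply: span_trans Spsi => u _.
Qed.

Lemma inSpan_image X : inSpan n X -> exists p, etaT n p = X.
Proof.
case/inSpanE => phi Sphi ->.
suff : span (@eta_fun m) (fun=> True) phi.
  by case/span_seq => p [_ ->]; exists p; rewrite etaTE.
apply: span_trans Sphi => z /has_counts_word[w /triangular_powerAj[c _ [psi Spsi E]]].
have normal_span u : span (@eta_fun m) (fun=> True) (normal u).
  by apply: triangular_span => {}u; exists u => //; apply: triangular_eta.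
rewrite (_ : powerAj z = fun tau => c * normal w tau + psi tau); last exact/funext.
by apply: span_add; [apply: span_scale | apply: span_trans Spsi => u _].
Qed.

(** Since [w] commutes with the shift by [l], acting on a sequence composes its periodic extension
    with [w]; the count is then reindexed along the bijection. *)
Lemma Mmat_actI (l : nat) i k (w : int -> int) : bijective w ->
  (forall x, w (x + l%:Z) = w x + l%:Z) -> size i = l -> size k = l ->
  Mmat n (actI n l i w) (actI n l k w) = Mmat n i k.
Proof.
move=> wbij wper il kl; rewrite /Mmat size_mkseq il.
case: l wper il kl => [//|l] wper il kl /=.
have extw i' s : size i' = l.+1 -> extI n (actI n l.+1 i' w) s = extI n i' (w s).
  move=> i'l; rewrite (@extIE _ l) ?size_mkseq // nth_mkseq //.
  have -> : w s = w (Posz (md l s).+1) + l.+1%:Z * qt l s.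
    pose f x := w x - x; have step x : f (x + l.+1%:Z) = f x by rewrite /f wper; ring.
    have := periodic_step step (Posz (md l s).+1) (qt l s);
      rewrite /f -int_md_qt => /(canRL (subrK _)) ->.
    by rewrite [X in _ + X](int_md_qt l s); set y := Posz _; ring.
  by rewrite !(@extIE _ l) // md_shift qt_shift; ring.
apply/funext => x; apply/funext => y; rewrite [RHS](reindex_fsbigT w) //.
by apply: eq_fsbigr => s _; rewrite !extw.
Qed.

Lemma Aj_inS A j r : validAj n (A, j) -> inS n r (Aj n A j).
Proof.
move=> V; split=> [k kr|w wbij wper i k ir kr]; last first.
  rewrite /Aj /Abr1; case: ifP => // _; apply: eq_fsbigr => la _.
  by rewrite !size_mkseq ir kr Mmat_actI.
(* Column finiteness is inherited from the finitely many words in an expression of [A[j]] as an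
   image under [etaT]. *)
have [p <-] : exists p, etaT n p = Aj n A j.
  apply: inSpan_image; apply/inSpanE; exists (powerAj (A, j)); last exact: AjE.
  exact: span_gen.
have /choice[S SP] := fun w : word => etaW_col_finite w r k.
exists (flatten [seq S t.2 | t <- p]) => i ir; apply: contraNT => iS.
rewrite /etaT big1_seq // => t /andP[_ tp]; apply/eqP; rewrite mulf_eq0; apply/orP; right.
apply: contraNT iS => /(SP _ _ ir) iS; apply/flattenP; exists (S t.2) => //.
by apply/mapP; exists t.
Qed.

Lemma Aj_indep (s : seq (rat * ((int -> int -> nat) * (int -> nat)))) :
  (forall t, List.In t s -> validAj n t.2) -> List.NoDup (map snd s) ->
  comboA n s = zeroOp -> forall t, List.In t s -> t.1 = 0.
Proof.
move=> sV s_uniq; rewrite comboAE // -(lift0 m) => /lift_inj s0 t ts.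
have sV' (u : 'I_(size s)) : validAj n (nth t s u).2 by apply/sV/nth_In.
have /choice[ld ldP] := fun u : 'I_(size s) => has_counts_word (sV' u).
have c0 := @triangular_indep m (size s) (fun x => (nth t s x).1)
  (fun x => powerAj (nth t s x).2) ld.
have [u us <-] := In_nth t ts; apply: (c0 _ _ _ (Ordinal us)) => [v|v v' vv'|T].
- exact: triangular_powerAj.
- have E := has_counts_inj (sV' v) (sV' v') (ldP v) (ldP v') vv'.
  apply: val_inj; apply: (@NoDup_nth_inj _ t.2 _ s_uniq) => /=; rewrite ?size_map ?ltn_ord //.
  by rewrite !(@nth_map _ t _ t.2).
- have := congr1 (fun f => f T) s0; rewrite (big_nth t) big_mkord; exact.
Qed.

End SpanOfAj.

Theorem theorem6p3p4 (n : nat) (hn : (2 <= n)%N) :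
  (* the A[j] lie in prod_r S_Delta(n,r)_Q *)
  (forall A j, validAj n (A, j) -> forall r, inS n r (Aj n A j)) /\
  (* the span is a subalgebra (contains 1, closed under product) *)
  inSpan n IdOp /\
  (forall X Y, inSpan n X -> inSpan n Y -> inSpan n (mulOp X Y)) /\
  (* the A[j] are linearly independent (hence a basis of the span) *)
  (forall s : seq (rat * ((int -> int -> nat) * (int -> nat))),
     (forall t, List.In t s -> validAj n t.2) -> List.NoDup (map snd s) ->
     comboA n s = zeroOp -> forall t, List.In t s -> t.1 = 0) /\
  (* eta factors through U = T(L)/I and is injective on U *)
  (forall p : TL n, inIdeal n p <-> etaT n p = zeroOp) /\
  (* its image is exactly the span *)
  (forall p : TL n, inSpan n (etaT n p)) /\
  (forall X, inSpan n X -> exists p : TL n, etaT n p = X).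
Proof.
case: n hn => // m _; split; first by move=> A j V r; apply: Aj_inS.
split.
  rewrite (_ : IdOp = etaT m.+1 [:: (1, [::])]); first exact: inSpan_etaT.
  apply/funext => r; apply/funext => i; apply/funext => k.
  by rewrite /etaT big_seq1 mul1r.
split.
  (* The span is the image of [etaT], so closure under products comes from the product of the tensor
     algebra. *)
  move=> X Y /inSpan_image[p <-] /inSpan_image[q <-].
  by rewrite mulOp_etaT; apply: inSpan_etaT.
split; first exact: Aj_indep.
split.
  move=> p; rewrite etaTE -(lift0 m); split=> [pI|/lift_inj p0].
    by congr lift; apply/funext => tau; apply: evalT_ideal.
  by apply: ideal_evalT => tau; rewrite p0.
split; [exact: inSpan_etaT | exact: inSpan_image].
Qed.
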